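(* Let $L$ be a lattice of rank $g$ and $Q$ a positive-definite quadratic form on $L_{\mathbb R}$ (given exactly). The Tropical Schottky Decision algorithm (described in the context) outputs ''Yes'' if and only if $Q\in\mathfrak J_g^{\mathrm{trop}}$. In that case, the Tropical Schottky Recovery algorithm (described in the context) outputs a metric graph with an integral cycle basis whose Riemann matrix is exactly $Q$.
   Context: $L$ is a free abelian group of rank $g$ (one may take $L=\mathbb Z^g$), $L_{\mathbb R}=L\otimes\mathbb R$, $L^*=\mathrm{Hom}(L,\mathbb Z)$; $[x]$ is the class of $x\in L$ in $L/2L$; $(L/2L)^*=\mathrm{Hom}_{\mathbb F_2}(L/2L,\mathbb F_2)$. Graphs: for a finite connected graph $\Gamma$ with edge lengths $\ell_f>0$ and oriented edges, $H_1(\Gamma,\mathbb Z)\subseteq\mathbb Z^{E(\Gamma)}$ is the lattice of integer flows (kernel of the boundary map head minus tail), of rank equal to the genus. The coedge $c_f$ is the restriction of the $f$-th coordinate to $H_1(\Gamma,\mathbb Z)$; a coedge matrix has as columns the coordinate vectors of the $c_f$ with respect to an integral basis of $H_1(\Gamma,\mathbb Z)$ (an integral cycle basis). The period form is $\sum_f\ell_f c_f^2$, with Riemann matrix $C\,\mathrm{diag}(\ell_f)\,C^{\mathsf T}$ for the coedge matrix $C$. $\mathfrak J^{\mathrm{trop}}_g$ is the set of positive-definite $Q$ on $L_{\mathbb R}$ for which there are a genus $g$ metric graph $\Gamma$ and an isomorphism $L\cong H_1(\Gamma,\mathbb Z)$ taking $Q$ to the period form. A matroid is cographic if it is isomorphic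 to the dual $M^*(G)$ of the graphic matroid of a graph $G$. All lattice minimizations below are assumed to be carried out exactly. Tropical Schottky Decision. Input: $Q$. (1) For each $\alpha\in L/2L$ compute $\mu(\alpha)=\min\{Q[x]:x\in L,[x]=\alpha\}$, retaining one shortest representative $r_\alpha\in\alpha$. (2) Compute $\lambda_e=-2^{1-g}\sum_{\alpha\in L/2L}(-1)^{e(\alpha)}\mu(\alpha)$ for $0\ne e\in(L/2L)^*$. (3) If some $\lambda_e<0$, output ''No'' and stop; otherwise set $E=\{e:\lambda_e>0\}$. (4) Form the binary matroid $M(E)$ on $E$ of linear independence in $(L/2L)^*$ over $\mathbb F_2$ and test whether it is cographic. If not, output ''No''. If so, recover a graph $G$ with a labelled matroid isomorphism $\phi:M^*(G)\to M(E)$, retain $(G,\phi)$, and output ''Yes''. Tropical Schottky Recovery. Input: $Q$ for which the decision algorithm returns ''Yes''. (1) Take the retained data $E,(\lambda_e),(r_\alpha),(G,\phi)$ and label the edges of $G$ by $E$ via $\phi$. (2) Give the edge labelled $e$ the length $\ell_e=\lambda_e$, and set $\Delta=\mathrm{diag}(\lambda_e)_{e\in E}$. (3) For each $e\in E$ choose a matroid basis $B_e\ni e$ of $M(E)$; for $b\in B_e$ let $\alpha_b^{B_e}\in L/2L$ be the vector dual to $b$ (i.e. $b'(\alpha_b^{B_e})=\delta_{b,b'}$ for $b'\in B_e$), set $L_e=\langle r_{\alpha_b^{B_e}}:b\in B_e\setminus\{e\}\rangle_{\mathbb Z}$, and compute a primitive covector $a_e\in L^*$ with $\ker(a_e)=L_e$;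 let $A=(a_e)_{e\in E}$ be the matrix with these columns. (4) Compute a coedge matrix $C=(c_e)_{e\in E}$ of $G$, and compute $U\in\mathrm{GL}_g(\mathbb Z)$ and a diagonal sign matrix $S=\mathrm{diag}(\varepsilon_e)$, $\varepsilon_e\in\{\pm1\}$, with $A=UCS$. (5) Reorient the edges according to $S$, set $C'=CS$, and output the metric graph $(G,\ell)$ with the integral cycle basis whose coedge matrix is $UC'$; its Riemann matrix is $UC'\Delta(C')^{\mathsf T}U^{\mathsf T}$. *)

(* Defs.v *)
From HB Require Import structures.
From mathcomp Require Import all_boot all_order all_algebra.
From mathcomp Require Import boolp reals.
Set Implicit Arguments.
Unset Strict Implicit.
Unset Printing Implicit Defensive.
Import Order.TTheory GRing.Theory Num.Theory.
Local Open Scope ring_scope.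

(** * Nondeterministic algorithms *)

(* [Pick T P k] is a step that computes some [x : T] meeting its specification
   [P] and goes on with [k x].  No assumption is made on which [x] is found. *)
Inductive algorithm (A : Type) : Type :=
| Output of A
| Pick (T : Type) of (T -> Prop) & (T -> algorithm A).

(* Total correctness: no step can get stuck, i.e. whatever was picked before,
   the object to be computed exists; and every run outputs a value satisfying
   [post]. *)
Fixpoint always_outputs (A : Type) (p : algorithm A) (post : A -> Prop) : Prop :=
  match p with
  | Output a => post a
  | Pick T P k =>
      (exists x : T, P x) /\ forall x : T, P x -> always_outputs (k x) post
  end.

(** * The lattice, its dual, and their reductions modulo 2 *)

(* L = Z^g; L^* is written in coordinates with respect to the dual basis, also
   as columns, so that covectors are the columns of coedge matrices; likewise
   for L/2L and (L/2L)^*. *)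
Notation lattice g := ('cV[int]_g) (only parsing).
Notation colattice g := ('cV[int]_g) (only parsing).
Notation lattice2 g := ('cV['F_2]_g) (only parsing).
Notation colattice2 g := ('cV['F_2]_g) (only parsing).

Definition pairing (K : pzRingType) (g : nat) (a x : 'cV[K]_g) : K :=
  (a^T *m x) 0 0.

Definition class2 (g : nat) (x : lattice g) : lattice2 g :=
  map_mx (fun n : int => n%:~R) x.

Definition primitive (g : nat) (a : colattice g) : Prop :=
  forall (k : int) (b : colattice g), a = k *: b -> `|k| = 1.

(** * Quadratic forms, given by their symmetric Gram matrices *)

Definition quad (R : pzRingType) (g : nat) (Q : 'M[R]_g) (x : 'cV[R]_g) : R :=
  (x^T *m Q *m x) 0 0.

Definition posdef (R : realType) (g : nat) (Q : 'M[R]_g) : Prop :=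
  Q^T = Q /\ forall x : 'cV[R]_g, x != 0 -> 0 < quad Q x.

Definition quadZ (R : realType) (g : nat) (Q : 'M[R]_g) (x : lattice g) : R :=
  quad Q (map_mx (fun n : int => n%:~R) x).

(** * Graphs *)

(* Finite oriented multigraphs; loops and parallel edges are allowed. *)
Record graph := Graph {
  vertex : finType;
  edge : finType;
  tail : edge -> vertex;
  head : edge -> vertex }.

Definition adjacent (G : graph) : rel (vertex G) :=
  [rel u v | [exists f : edge G, ((tail f == u) && (head f == v))
                              || ((tail f == v) && (head f == u))]].

Definition connected_graph (G : graph) : Prop :=
  (0 < #|vertex G|)%N /\ forall u v : vertex G, connect (@adjacent G) u v.

Definition genus (G : graph) : int := #|edge G|%:Z - #|vertex G|%:Z + 1.

(* [(f, b)] is the edge [f], traversed from tail to head iff [b]. *)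
Definition dart (G : graph) : Type := (edge G * bool)%type.
Definition dart_src (G : graph) (d : dart G) : vertex G :=
  if d.2 then tail d.1 else head d.1.
Definition dart_tgt (G : graph) (d : dart G) : vertex G :=
  if d.2 then head d.1 else tail d.1.

(* Simple cycles: distinct vertices and distinct edges; a loop, or a pair of
   parallel edges, is a cycle. *)
Definition graph_cycle (G : graph) (c : seq (dart G)) : Prop :=
  [/\ c <> [::], uniq [seq d.1 | d <- c], uniq [seq dart_src d | d <- c]
    & cycle [rel d d' | dart_tgt d == dart_src d'] c].

(** ** Integer flows and period forms *)

(* H_1(G, Z), the kernel of the boundary map. *)
Definition is_flow (G : graph) (x : {ffun edge G -> int}) : Prop :=
  forall v : vertex G,
    \sum_(f : edge G | head f == v) x f - \sum_(f : edge G | tail f == v) x f = 0.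

Definition coedge (G : graph) (f : edge G) (x : {ffun edge G -> int}) : int := x f.

Definition integral_cycle_basis (G : graph) (g : nat)
    (b : 'I_g -> {ffun edge G -> int}) : Prop :=
  (forall i, is_flow (b i)) /\
  forall x, is_flow x -> exists! n : {ffun 'I_g -> int}, x = \sum_(i < g) b i *~ n i.

(* Column [j] belongs to the edge [enum_val j]; the coordinates of a linear
   form in the basis dual to [b] are its values on [b]. *)
Definition coedge_matrix (G : graph) (g : nat)
    (b : 'I_g -> {ffun edge G -> int}) : 'M[int]_(g, #|edge G|) :=
  \matrix_(i, j) coedge (enum_val j) (b i).

Definition is_metric_graph (R : realType) (G : graph) (len : edge G -> R) : Prop :=
  connected_graph G /\ forall f, 0 < len f.

Definition period_form (R : realType) (G : graph) (len : edge G -> R)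
    (x : {ffun edge G -> int}) : R :=
  \sum_(f : edge G) len f * (coedge f x)%:~R ^+ 2.

Definition edge_diag (K : pzRingType) (G : graph) (d : edge G -> K)
    : 'M[K]_#|edge G| :=
  diag_mx (\row_j d (enum_val j)).

Definition riemann_matrix (R : realType) (G : graph) (len : edge G -> R) (g : nat)
    (b : 'I_g -> {ffun edge G -> int}) : 'M[R]_g :=
  let C := map_mx (fun n : int => n%:~R) (coedge_matrix b) in
  C *m edge_diag len *m C^T.

Definition tropical_jacobian_locus (R : realType) (g : nat) (Q : 'M[R]_g) : Prop :=
  posdef Q /\
  exists (G : graph) (len : edge G -> R),
    [/\ is_metric_graph len, genus G = g%:Z
      & exists h : {additive lattice g -> {ffun edge G -> int}},
          [/\ injective h,
              forall y, is_flow y <-> exists x, h x = y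
            & forall x, quadZ Q x = period_form len (h x)]].

(** * Matroids *)

(* A matroid is given by its ground set and its independent sets; the matroid
   axioms are not part of the record. *)
Record matroid (T : finType) := Matroid {
  ground : {set T};
  indep : {set T} -> Prop }.

Definition matroid_basis (T : finType) (M : matroid T) (B : {set T}) : Prop :=
  indep M B /\ forall X : {set T}, indep M X -> B \subset X -> X = B.

Definition dual_matroid (T : finType) (M : matroid T) : matroid T :=
  Matroid (ground M)
    (fun X => X \subset ground M /\
              exists B, matroid_basis M B /\ [disjoint X & B]).

Definition matroid_iso (T T' : finType) (M : matroid T) (M' : matroid T')
    (phi : T -> T') : Prop :=
  [/\ {in ground M &, injective phi},
      phi @: ground M = ground M'
    & forall X : {set T}, X \subset ground M -> (indep M X <-> indep M' (phi @: X))].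

Definition graphic_matroid (G : graph) : matroid (edge G) :=
  Matroid [set: edge G]
    (fun X => forall c : seq (dart G), graph_cycle c ->
                ~ {subset [seq d.1 | d <- c] <= X}).

Definition cographic (T : finType) (M : matroid T) : Prop :=
  exists (G : graph) (phi : edge G -> T),
    matroid_iso (dual_matroid (graphic_matroid G)) M phi.

Definition binary_matroid (g : nat) (E : {set colattice2 g})
    : matroid (colattice2 g) :=
  Matroid E (fun X => X \subset E /\ free (enum X)).

(** * Tropical Schottky Decision *)

Record retained_data (R : realType) (g : nat) := RetainedData {
  supp : {set colattice2 g};
  lam : colattice2 g -> R;
  rep : lattice2 g -> lattice g;
  rgraph : graph;
  label : edge rgraph -> colattice2 g }.
Arguments label {R g} r f.

Inductive decision_output (R : realType) (g : nat) :=
| No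
| Yes of retained_data R g.
Arguments No {R g}.

Definition shortest_representative (R : realType) (g : nat) (Q : 'M[R]_g)
    (alpha : lattice2 g) (r : lattice g) : Prop :=
  class2 r = alpha /\
  forall x : lattice g, class2 x = alpha -> quadZ Q r <= quadZ Q x.

Definition schottky_lambda (R : realType) (g : nat) (mu : lattice2 g -> R)
    (e : colattice2 g) : R :=
  - 2%:R ^ (1 - g%:Z) *
    \sum_(alpha : lattice2 g) (-1) ^+ (pairing e alpha : nat) * mu alpha.

(* The recovered graph is taken connected, because it has to become a metric
   graph. *)
Definition schottky_decision (R : realType) (g : nat) (Q : 'M[R]_g)
    : algorithm (decision_output R g) :=
  Pick (fun r : lattice2 g -> lattice g =>
          forall alpha, shortest_representative Q alpha (r alpha))
  (fun r =>
   let mu alpha := quadZ Q (r alpha) in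
   let lambda := schottky_lambda mu in
   if [exists e : colattice2 g, (e != 0) && (lambda e < 0)] then Output No
   else
     let E := [set e : colattice2 g | (e != 0) && (0 < lambda e)] in
     if ~~ `[< cographic (binary_matroid E) >] then Output No
     else
       Pick (fun Gphi : {G : graph & edge G -> colattice2 g} =>
               connected_graph (tag Gphi) /\
               matroid_iso (dual_matroid (graphic_matroid (tag Gphi)))
                           (binary_matroid E) (tagged Gphi))
       (fun Gphi => Output (Yes (RetainedData E lambda r (tagged Gphi))))).

(** * Tropical Schottky Recovery *)

(* A graph with edge lengths and a [g]-tuple of elements of Z^E; the expected
   properties are proved of the output rather than built in. *)
Record recovery_output (R : realType) (g : nat) := RecoveryOutput {
  out_graph : graph;
  out_len : edge out_graph -> R;
  out_basis : 'I_g -> {ffun edge out_graph -> int} }.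
Arguments out_len {R g} r f.
Arguments out_basis {R g} r i.

Definition reorient (G : graph) (eps : edge G -> int) : graph :=
  @Graph (vertex G) (edge G)
    (fun f => if eps f == 1 then tail f else head f)
    (fun f => if eps f == 1 then head f else tail f).

(* The matrices are indexed by the edges of the retained graph; the column of
   the edge [f] is the one belonging to its label [label f] in [supp D]. *)
Definition schottky_recovery (R : realType) (g : nat) (D : retained_data R g)
    : algorithm (recovery_output R g) :=
  let E := supp D in
  let G := rgraph D in
  let phi := label D in
  let len f := lam D (phi f) in
  Pick (fun B : colattice2 g -> {set colattice2 g} =>
          forall e, e \in E -> matroid_basis (binary_matroid E) (B e) /\ e \in B e)
  (fun B =>
  Pick (fun alpha : colattice2 g -> colattice2 g -> lattice2 g =>
          forall e, e \in E -> forall b b', b \in B e -> b' \in B e ->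
            pairing b' (alpha e b) = (b == b')%:R)
  (fun alpha =>
  Pick (fun a : colattice2 g -> colattice g =>
          forall e, e \in E -> primitive (a e) /\
            forall x : lattice g, pairing (a e) x = 0 <->
              inIntSpan [seq rep D (alpha e b) | b <- enum (B e :\ e)] x)
  (fun a =>
   let A : 'M[int]_(g, #|edge G|) := \matrix_(i, j) a (phi (enum_val j)) i 0 in
  Pick (fun C : 'M[int]_(g, #|edge G|) =>
          exists2 b, @integral_cycle_basis G g b & C = coedge_matrix b)
  (fun C =>
  Pick (fun Ueps : 'M[int]_g * (edge G -> int) =>
          [/\ Ueps.1 \in unitmx,
              forall f, Ueps.2 f = 1 \/ Ueps.2 f = -1
            & A = Ueps.1 *m C *m edge_diag Ueps.2])
  (fun Ueps =>
   let U := Ueps.1 in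
   let C' := C *m edge_diag Ueps.2 in
   Output (@RecoveryOutput R g (reorient Ueps.2) len
             (fun i => [ffun f => (U *m C') i (enum_rank f)]))))))).

(* Main.v *)
From HB Require Import structures.
From mathcomp Require Import all_boot all_order all_algebra.
From mathcomp Require Import boolp reals.
From mathcomp Require Import ring lra zify.
Require Import Defs.
Set Implicit Arguments.
Unset Strict Implicit.
Unset Printing Implicit Defensive.
Import Order.TTheory GRing.Theory Num.Theory.
Local Open Scope ring_scope.

(** Write [q] for the form and [mu] for its minima on the classes of [L/2L].  The
    numbers [lambda e] are a Fourier transform of [mu], which can be inverted:
    [mu alpha] is the sum of the [lambda e] with [e alpha = 1].

    If [q] is the period form of a graph, every class of flows modulo 2 contains a
    flow with coordinates 0, 1 and -1, since a binary cycle is a disjoint union of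
    simple cycles, which can be oriented.  Hence [mu alpha] is the sum of the
    lengths of the odd edges, and [lambda e] is the total length of the edges with
    coedge [e] modulo 2, which is nonnegative.  Contracting all the edges but one
    for each coedge in the support shows that the matroid is cographic.

    Conversely, suppose only that no [lambda e] is negative, and let [E] be the
    support.  Then [q] is a sum of squares [lambda e * a_e ^ 2] with integral
    covectors [a_e] that reduce to [e] modulo 2 ([sum_of_squares]).  The engine is
    [shortest_halves].  Let [x], [y], [t] be shortest vectors with
    [x + y + t = 2 h].  The values of [h], [h - x], [h - y], [h - t] add up to those
    of [x], [y], [t], whereas the minima of their classes add up to at least as much,
    so these vectors are shortest in their classes, and every [e] in [E] vanishing on
    [x] and [y] vanishes on [h].  For two vectors dual to elements of a basis [B]
    contained in [E], this leaves for [h] the classes of 0, [x], [y] and [x + y];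
    one of the four vectors is then zero, that is, [t] is [x + y] or [x - y] up to
    sign.  So the Gram matrix of the shortest vectors dual to [B] is known up to the
    signs of its entries, and a minimality argument ([sgn_triangle]) makes these
    signs multiplicative among the vectors on which a given [e] does not vanish,
    which is what turns the form into a sum of squares ([quadZ_dual_family]).  The
    same principle, with exchanges between bases, shows that these vectors generate
    the lattice ([dual_family_span]).

    When moreover the matroid of [E] is that of the cycle space of a connected graph
    [G], the coordinates [a_e] have to be identified with those of the flows of [G].
    Every relation modulo 2 between elements of [E] lifts to a relation between the
    [a_e] with coefficients 1 and -1 ([covector_relation]); this applies to the star
    of each vertex.  Half the sum of these relations is again a relation, so its
    support modulo 2 is orthogonal to the cycles and is a cut.  Changing signs on one
    side of this cut makes the star relations those of an orientation, up to the
    signs of the [a_e] ([ex_orientation]).  Thus the [a_e] define an isomorphism from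
    the lattice to the flows of [G], which takes [q] to the period form.

    For the recovery, a primitive covector is determined up to sign by its kernel, so
    the covectors that the algorithm computes are the [a_e] up to sign, and the
    isomorphism provides the unimodular matrix.  As [A = U C S], the output basis has
    the coedge matrix [A], whose Riemann matrix is the given one. *)

(** * Arithmetic modulo 2 *)

Lemma F2_neq0 (x : 'F_2) : x != 0 -> x = 1.
Proof. by case: x => [[|[|m]] hm] //= _; apply/val_inj. Qed.

Lemma F2E (x : 'F_2) : x = (x != 0)%:R.
Proof. by have [->|/F2_neq0 ->] := eqVneq x 0. Qed.

Lemma F2_addxx (x : 'F_2) : x + x = 0.
Proof. by rewrite [x]F2E; case: (x != 0); apply/val_inj. Qed.

Lemma F2_opp (x : 'F_2) : - x = x.
Proof. by rewrite -[LHS]addr0 -(F2_addxx x) addKr. Qed.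

Lemma F2_addb (x y : 'F_2) : (x + y != 0) = (x != 0) (+) (y != 0).
Proof. by rewrite {1}[x]F2E {1}[y]F2E; case: (x != 0); case: (y != 0). Qed.

Lemma F2_nat (x : 'F_2) : (x : nat) = (x != 0).
Proof. by have [->|/F2_neq0 ->] := eqVneq x 0. Qed.

Lemma F2_int_eq0 (n : int) : ((n%:~R : 'F_2) == 0) = (2 %| n)%Z.
Proof. by rewrite -(dvdz_pcharf (pchar_Fp _)). Qed.

Lemma F2_int_half (n : int) : (n%:~R : 'F_2) = 0 -> exists m : int, n = m + m.
Proof. by move/eqP; rewrite F2_int_eq0 => /dvdzP[m ->]; exists m; lia. Qed.

Lemma F2_int_sqr (n : int) : ((n%:~R : 'F_2) != 0)%:Z <= n ^+ 2.
Proof.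
have [->|n0] := eqVneq n 0; first by rewrite eqxx.
by rewrite (le_trans (_ : _ <= 1)) ?lez_nat ?leq_b1 //; nia.
Qed.

Lemma F2_vec_addxx g (x : 'cV['F_2]_g) : x + x = 0.
Proof. by apply/matrixP=> i j; rewrite !mxE F2_addxx. Qed.

Lemma F2_vec_opp g (x : 'cV['F_2]_g) : - x = x.
Proof. by apply/matrixP=> i j; rewrite !mxE F2_opp. Qed.

Lemma F2_vec_add_eq0 g (x y : 'cV['F_2]_g) : x + y = 0 -> x = y.
Proof. by move/eqP; rewrite addr_eq0 F2_vec_opp => /eqP. Qed.

(** * Pairings *)

Section Pairing.
Variables (K : comPzRingType) (g : nat).
Implicit Types a b x y : 'cV[K]_g.

Lemma pairingE a x : pairing a x = \sum_i a i 0 * x i 0.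
Proof. by rewrite /pairing mxE; apply: eq_bigr => i _; rewrite mxE. Qed.

Lemma pairingC a x : pairing a x = pairing x a.
Proof. by rewrite !pairingE; apply: eq_bigr => i _; rewrite mulrC. Qed.

Lemma pairingDr a x y : pairing a (x + y) = pairing a x + pairing a y.
Proof. by rewrite /pairing mulmxDr mxE. Qed.

Lemma pairingDl a b x : pairing (a + b) x = pairing a x + pairing b x.
Proof. by rewrite !(pairingC _ x) pairingDr. Qed.

Lemma pairing0r a : pairing a 0 = 0.
Proof. by rewrite /pairing mulmx0 mxE. Qed.

Lemma pairing0l x : pairing 0 x = 0.
Proof. by rewrite pairingC pairing0r. Qed.

Lemma pairingNr a x : pairing a (- x) = - pairing a x.
Proof. by rewrite /pairing mulmxN mxE. Qed.

Lemma pairingNl a x : pairing (- a) x = - pairing a x.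
Proof. by rewrite !(pairingC _ x) pairingNr. Qed.

Lemma pairingZr c a x : pairing a (c *: x) = c * pairing a x.
Proof. by rewrite /pairing -scalemxAr mxE. Qed.

Lemma pairingZl c a x : pairing (c *: a) x = c * pairing a x.
Proof. by rewrite !(pairingC _ x) pairingZr. Qed.

Lemma pairing_sumr (I : finType) (P : pred I) a (F : I -> 'cV[K]_g) :
  pairing a (\sum_(i | P i) F i) = \sum_(i | P i) pairing a (F i).
Proof. by apply: big_morph => [u v|]; rewrite ?pairingDr ?pairing0r. Qed.

Lemma pairing_suml (I : finType) (P : pred I) (F : I -> 'cV[K]_g) x :
  pairing (\sum_(i | P i) F i) x = \sum_(i | P i) pairing (F i) x.
Proof. by rewrite pairingC pairing_sumr; under eq_bigr do rewrite pairingC. Qed.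

Lemma pairing_delta a i : pairing a (delta_mx i 0) = a i 0.
Proof.
rewrite pairingE (bigD1 i) //= mxE !eqxx mulr1 big1 ?addr0 // => j ji.
by rewrite mxE (negPf ji) mulr0.
Qed.

Lemma pairing_inj a b : (forall x, pairing a x = pairing b x) -> a = b.
Proof.
by move=> eq_ab; apply/matrixP=> i j; rewrite ord1 -!pairing_delta eq_ab.
Qed.

End Pairing.

Section Reduction.
Variable g : nat.
Implicit Types (x y : 'cV[int]_g) (e alpha : 'cV['F_2]_g).

(** A boolean, so that sums become exclusive disjunctions and inequalities between
    weights can be checked by cases. *)
Definition bit e alpha : bool := pairing e alpha != 0.

Lemma pairing_bit e alpha : pairing e alpha = (bit e alpha)%:R.
Proof. exact: F2E. Qed.

Lemma bitP e alpha : reflect (pairing e alpha = 0) (~~ bit e alpha).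
Proof. by rewrite negbK; apply: eqP. Qed.

Lemma bitC e alpha : bit e alpha = bit alpha e.
Proof. by rewrite /bit pairingC. Qed.

Lemma bitD e alpha beta : bit e (alpha + beta) = bit e alpha (+) bit e beta.
Proof. by rewrite /bit pairingDr F2_addb. Qed.

Lemma bitDl e f alpha : bit (e + f) alpha = bit e alpha (+) bit f alpha.
Proof. by rewrite !(bitC _ alpha) bitD. Qed.

Lemma bit0 e : bit e 0 = false.
Proof. by rewrite /bit pairing0r eqxx. Qed.

Lemma bit_inj alpha beta : (forall e, bit e alpha = bit e beta) -> alpha = beta.
Proof.
move=> eq_b; apply: pairing_inj => e.
by rewrite !(pairingC _ e) !pairing_bit eq_b.
Qed.

Lemma class2E x i j : class2 x i j = (x i j)%:~R.
Proof. by rewrite mxE. Qed.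

Lemma class2D x y : class2 (x + y) = class2 x + class2 y.
Proof. by apply/matrixP=> i j; rewrite !mxE intrD. Qed.

Lemma class2_0 : class2 (0 : 'cV[int]_g) = 0.
Proof. by apply/matrixP=> i j; rewrite !mxE. Qed.

Lemma class2N x : class2 (- x) = class2 x.
Proof. by apply/matrixP=> i j; rewrite !mxE intrN F2_opp. Qed.

Lemma class2B x y : class2 (x - y) = class2 x + class2 y.
Proof. by rewrite class2D class2N. Qed.

Lemma class2Z n x : class2 (n *: x) = n%:~R *: class2 x.
Proof. by apply/matrixP=> i j; rewrite !mxE intrM. Qed.

Lemma class2_half x : class2 x = 0 -> exists y, x = y + y.
Proof.
move=> x0; have [y xy] : exists y, forall i, x i 0 = y i 0 + y i 0.
  have half i : exists n : int, x i 0 = n + n.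
    by apply: F2_int_half; move/matrixP/(_ i 0): x0; rewrite !mxE.
  by have [y hy] := choice half; exists (\col_i y i) => i; rewrite mxE.
by exists y; apply/matrixP=> i j; rewrite ord1 mxE.
Qed.

Lemma class2_surj alpha : exists x, class2 x = alpha.
Proof.
exists (map_mx (fun u : 'F_2 => Posz u) alpha); apply/matrixP=> i j.
by rewrite !mxE [RHS]F2E -F2_nat.
Qed.

Lemma pairing_class2 a x : pairing (class2 a) (class2 x) = (pairing a x)%:~R.
Proof.
rewrite !pairingE (big_morph _ (intrD _) (erefl _)).
by apply: eq_bigr => i _; rewrite !mxE intrM.
Qed.

Lemma bit_class2 a x : bit (class2 a) (class2 x) = ((pairing a x)%:~R != 0 :> 'F_2).
Proof. by rewrite /bit pairing_class2. Qed.

Lemma bitE e alpha : bit e alpha = (pairing e alpha != 0).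
Proof. by []. Qed.

Lemma class2_neq0 x : class2 x != 0 -> x != 0.
Proof. by apply: contra_neq => ->; rewrite class2_0. Qed.

End Reduction.

(** * A common kernel determines a span *)

(** If [u] vanishes on the common kernel of finitely many functionals [F i],
    peeling them off one at a time writes [u] as their combination: on the
    kernel of [F i], by induction, and off it because two points outside this
    kernel differ by a point inside.  [Z] is the subgroup reached so far. *)
Lemma F2_functional_span (V : zmodType) (I : finType) (F : I -> V -> 'F_2)
    (u : V -> 'F_2) (Z : V -> Prop) :
  (forall x y, Z x -> Z y -> Z (x + y)) ->
  (forall i, {morph F i : x y / x + y}) -> {morph u : x y / x + y} ->
  (forall z, Z z -> (forall i, F i z = 0) -> u z = 0) ->
  exists c : I -> 'F_2, forall z, Z z -> u z = \sum_i c i * F i z.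
Proof.
move=> ZD FD uD uF.
suff main (s : seq I) : forall (Z : V -> Prop),
    (forall x y, Z x -> Z y -> Z (x + y)) ->
    (forall z, Z z -> (forall i, i \in s -> F i z = 0) -> u z = 0) ->
    exists c : I -> 'F_2, forall z, Z z -> u z = \sum_i c i * F i z.
  by apply: (main (enum I) Z) => // z Zz Fz; apply: uF => // i; rewrite Fz ?mem_enum.
elim: s => [|k s IHs] {uF ZD}Z ZD uF.
  by exists (fun=> 0) => z Zz; rewrite uF // big1 // => i _; rewrite mul0r.
have [x y [Zx Fx] [Zy Fy]|z [Zz Fz] Fsz|c uc] := IHs (fun z => Z z /\ F k z = 0).
- by split; [apply: ZD | rewrite FD Fx Fy addr0].
- by apply: uF => // i; rewrite inE => /predU1P[->|/Fsz].
pose v z := u z + \sum_i c i * F i z.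
have vD : {morph v : x y / x + y}.
  move=> x y; rewrite /v uD addrACA; congr (_ + _); rewrite -big_split.
  by apply: eq_bigr => i _; rewrite FD mulrDr.
have vF z : Z z -> F k z = 0 -> v z = 0 by move=> Zz Fz; rewrite /v -uc ?F2_addxx.
have uE z : u z = v z + \sum_i c i * F i z by rewrite /v -addrA F2_addxx addr0.
have [[z0 [Zz0 Fz0]]|noz] := pselect (exists z0, Z z0 /\ F k z0 != 0).
  exists (fun i => c i + (i == k)%:R * v z0) => z Zz; rewrite uE addrC.
  under [RHS]eq_bigr do rewrite mulrDl.
  rewrite big_split /=; congr (_ + _).
  rewrite (bigD1 k) //= eqxx mul1r big1 => [|i /negPf->]; last by rewrite !mul0r.
  rewrite addr0; have [/eqP Fz|/F2_neq0 Fz] := boolP (F k z == 0).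
    by rewrite vF // Fz mulr0.
  have : v (z + z0) = 0 by rewrite vF ?FD ?Fz ?(F2_neq0 Fz0) ?F2_addxx //; apply: ZD.
  by rewrite vD Fz mulr1 => /eqP; rewrite addr_eq0 F2_opp => /eqP.
exists c => z Zz; rewrite -uc //; split=> //; apply/eqP/negPn/negP => Fz.
by apply: noz; exists z.
Qed.

(** * Inverting the transform *)

Section Fourier.
Variables (R : realType) (g : nat).
Implicit Types (e alpha beta : 'cV['F_2]_g) (mu : 'cV['F_2]_g -> R).

Lemma sum_sign_bit e :
  \sum_alpha (-1) ^+ bit e alpha = 2 ^+ g * (e == 0)%:R :> R.
Proof.
have [->|e0] := eqVneq e 0.
  under eq_bigr do rewrite bitC bit0.
  by rewrite sumr_const card_mx card_Fp // muln1 natrX mulr1.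
have [beta eb] : exists beta, bit e beta.
  apply: contrapT => noeb.
  case/eqP: e0; apply: bit_inj => beta; rewrite bit0 bitC.
  by apply/negbTE/negP => eb; apply: noeb; exists beta.
rewrite mulr0; set S := \sum_alpha _.
have selfN (x : R) : x = - x -> x = 0 by lra.
apply: selfN.
rewrite {1}/S (reindex_inj (addrI beta)) -sumrN; apply: eq_bigr => alpha _.
by rewrite bitD eb; case: bit; rewrite /= ?expr0 ?expr1 ?opprK.
Qed.

Lemma schottky_lambdaE mu e :
  schottky_lambda mu e =
  - (2 / 2 ^+ g) * \sum_alpha (-1) ^+ bit e alpha * mu alpha.
Proof.
rewrite /schottky_lambda expfzDr ?pnatr_eq0 // expr1z exprnN; congr (_ * _).
by apply: eq_bigr => alpha _; rewrite F2_nat.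
Qed.

Lemma sign_boolE (b : bool) : (-1) ^+ b = 1 - 2 * b%:R :> R.
Proof. by case: b; rewrite ?expr0 ?expr1 /=; lra. Qed.

(** By orthogonality of the characters, only the terms of [mu] at [0] and at [alpha]
    survive the summation over [e]. *)
Lemma schottky_inversion mu alpha :
  mu alpha = mu 0 + \sum_e schottky_lambda mu e * (bit e alpha)%:R.
Proof.
have pow0 : 2 ^+ g != 0 :> R by rewrite expf_neq0 // pnatr_eq0.
under eq_bigr => e _ do rewrite schottky_lambdaE -mulrA mulr_suml.
rewrite -mulr_sumr exchange_big /=.
under eq_bigr => beta _.
  under eq_bigr => e _.
    have -> : (-1) ^+ bit e beta * mu beta * (bit e alpha)%:R =
      (mu beta / 2) * ((-1) ^+ bit beta e - (-1) ^+ bit (alpha + beta) e).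
      rewrite ![bit _ e]bitC bitD !sign_boolE.
      by case: (bit e alpha); case: (bit e beta) => /=; lra.
    over.
  rewrite -mulr_sumr sumrB !sum_sign_bit -mulrBr; over.
under eq_bigr do rewrite mulrBr mulrBr.
rewrite sumrB (bigD1 0) //= eqxx big1 => [|i /negPf->]; last by rewrite !mulr0.
rewrite (bigD1 alpha) //= F2_vec_addxx eqxx big1 => [|i ia]; last first.
  case: eqP => [/F2_vec_add_eq0 ai|_]; last by rewrite !mulr0.
  by rewrite ai eqxx in ia.
rewrite !addr0 mulr1n; field; exact: pow0.
Qed.

(** As [bit (c i)] is [(1 - (-1) ^+ bit (c i)) / 2], orthogonality of the characters
    concentrates its transform, away from [0], at [c i]. *)
Lemma schottky_lambda_weights (I : finType) (len : I -> R) (c : I -> 'cV['F_2]_g)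
    mu e : e != 0 ->
  (forall alpha, mu alpha = \sum_i len i * (bit (c i) alpha)%:R) ->
  schottky_lambda mu e = \sum_(i | c i == e) len i.
Proof.
move=> e0 muE; have pow0 : 2 ^+ g != 0 :> R by rewrite expf_neq0 // pnatr_eq0.
rewrite schottky_lambdaE; under eq_bigr do rewrite muE mulr_sumr.
rewrite exchange_big mulr_sumr [RHS]big_mkcond; apply: eq_bigr => i _ /=.
under eq_bigr => alpha _.
  have -> : (-1) ^+ bit e alpha * (len i * (bit (c i) alpha)%:R) =
    (len i / 2) * ((-1) ^+ bit e alpha - (-1) ^+ bit (e + c i) alpha).
    by rewrite bitDl !sign_boolE; case: bit; case: bit => /=; lra.
  over.
rewrite -mulr_sumr sumrB !sum_sign_bit (negPf e0) mulr0 sub0r.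
have -> : (e + c i == 0) = (c i == e).
  apply/eqP/eqP => [/F2_vec_add_eq0 //|->]; exact: F2_vec_addxx.
by case: eqP => _; rewrite ?mulr1n ?mulr0n; field; exact: pow0.
Qed.

End Fourier.

(** * Positive-definite forms on the lattice *)

Section Form.
Variables (R : realType) (g : nat) (Q : 'M[R]_g).
Hypothesis hQ : posdef Q.
Implicit Types x y z t : 'cV[int]_g.

Definition realvec x : 'cV[R]_g := map_mx (fun n : int => n%:~R) x.

Let rform (u v : 'cV[R]_g) : R := (u^T *m Q *m v) 0 0.

Definition bform x y : R := ((realvec x)^T *m Q *m realvec y) 0 0.

Let rformC u v : rform u v = rform v u.
Proof.
have tr1 (A : 'M[R]_1) : A 0 0 = A^T 0 0 by rewrite mxE.
by rewrite /rform [LHS]tr1 !trmx_mul trmxK hQ.1 mulmxA.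
Qed.

Let rformBr u v w : rform u (v - w) = rform u v - rform u w.
Proof. by rewrite /rform mulmxBr !mxE. Qed.

Let rformZr c u v : rform u (c *: v) = c * rform u v.
Proof. by rewrite /rform -scalemxAr mxE. Qed.

Lemma quadZE x : quadZ Q x = bform x x. Proof. by []. Qed.

Lemma realvecD x y : realvec (x + y) = realvec x + realvec y.
Proof. by apply/matrixP=> i j; rewrite !mxE intrD. Qed.

Lemma realvecZ n x : realvec (n *: x) = n%:~R *: realvec x.
Proof. by apply/matrixP=> i j; rewrite !mxE intrM. Qed.

Lemma bformC x y : bform x y = bform y x.
Proof. exact: rformC. Qed.

Lemma bformDr x y z : bform x (y + z) = bform x y + bform x z.
Proof. by rewrite /bform realvecD mulmxDr mxE. Qed.

Lemma bformDl x y z : bform (x + y) z = bform x z + bform y z.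
Proof. by rewrite !(bformC _ z) bformDr. Qed.

Lemma bformZr n x y : bform x (n *: y) = n%:~R * bform x y.
Proof. by rewrite /bform realvecZ -scalemxAr mxE. Qed.

Lemma bformZl n x y : bform (n *: x) y = n%:~R * bform x y.
Proof. by rewrite !(bformC _ y) bformZr. Qed.

Lemma bformNr x y : bform x (- y) = - bform x y.
Proof. by rewrite -scaleN1r bformZr mulN1r. Qed.

Lemma bformNl x y : bform (- x) y = - bform x y.
Proof. by rewrite !(bformC _ y) bformNr. Qed.

Lemma bform0r x : bform x 0 = 0.
Proof. by rewrite -(scale0r 0) bformZr mul0r. Qed.

Lemma bform_sumr (I : finType) x (F : I -> 'cV[int]_g) :
  bform x (\sum_i F i) = \sum_i bform x (F i).
Proof. by apply: big_morph => [u v|]; rewrite ?bformDr ?bform0r. Qed.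

Lemma bform_suml (I : finType) (F : I -> 'cV[int]_g) y :
  bform (\sum_i F i) y = \sum_i bform (F i) y.
Proof. by rewrite bformC bform_sumr; under eq_bigr do rewrite bformC. Qed.

Lemma bform_delta i k : bform (delta_mx i 0) (delta_mx k 0) = Q i k.
Proof.
rewrite /bform /realvec !map_delta_mx trmx_delta -rowE -colE.
by rewrite !mxE.
Qed.

Definition bformE := (bformDl, bformDr, bformNl, bformNr, bformZl, bformZr).

Lemma quadZ_gt0 x : x != 0 -> 0 < quadZ Q x.
Proof.
move=> x0; apply: hQ.2; apply: contra_neq x0 => /matrixP x0.
by apply/matrixP=> i j; move/(_ i j)/eqP: x0; rewrite !mxE intr_eq0 => /eqP.
Qed.

Lemma quadZ0 : quadZ Q 0 = 0.
Proof. by rewrite quadZE bform0r. Qed.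

Lemma quadZ_eq0 x : quadZ Q x <= 0 -> x = 0.
Proof.
by move=> q0; apply/eqP/negPn/negP => /quadZ_gt0; rewrite ltNge q0.
Qed.

Lemma quadZ_ge0 x : 0 <= quadZ Q x.
Proof.
by have [->|/quadZ_gt0/ltW//] := eqVneq x 0; rewrite quadZ0.
Qed.

Lemma quadZN x : quadZ Q (- x) = quadZ Q x.
Proof. by rewrite !quadZE !bformE opprK. Qed.

Lemma quadZ_parallelogram x y :
  quadZ Q (x + y) + quadZ Q (x - y) = 2 * quadZ Q x + 2 * quadZ Q y.
Proof. by rewrite !quadZE !bformE (bformC y x); ring. Qed.

(** By the Cauchy-Schwarz inequality, the coordinate [x i], which is the product
    of [x] with the vector [Q^-1 e_i], is bounded by the value of the form. *)
Lemma posdef_coord_bound i : exists2 K : R, 0 <= K &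
  forall x : 'cV[R]_g, x i 0 ^+ 2 <= K * quad Q x.
Proof.
have unitQ : Q \in unitmx.
  rewrite -row_free_unit -kermx_eq0; apply/eqP/row_matrixP => k; rewrite row0.
  have kerQ : row k (kermx Q) *m Q = 0 by rewrite -row_mul mulmx_ker row0.
  apply: trmx_inj; rewrite trmx0; apply/eqP/negPn/negP => /hQ.2.
  by rewrite /quad trmxK kerQ mul0mx mxE ltxx.
pose v := invmx Q *m delta_mx i (0 : 'I_1).
have vx (x : 'cV[R]_g) : (v^T *m Q *m x) 0 0 = x i 0.
  rewrite /v trmx_mul trmx_inv hQ.1 -(mulmxA _ _ Q) mulVmx // mulmx1.
  by rewrite trmx_delta -rowE mxE.
have v0 : v != 0.
  apply: contraTneq isT => v0; have := vx (delta_mx i 0).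
  by rewrite v0 trmx0 mul0mx mul0mx !mxE !eqxx => /eqP; rewrite eq_sym oner_eq0.
exists (quad Q v) => [|x]; first exact/ltW/hQ.2.
pose w := quad Q v *: x - x i 0 *: v.
have : 0 <= quad Q w.
  have [->|/hQ.2/ltW//] := eqVneq w 0.
  by rewrite /quad mulmx0 mxE.
have xv : rform x v = x i 0 by rewrite rformC -vx.
rewrite -[quad Q w]/(rform w w) /w rformBr !rformZr ![rform (_ - _) _]rformC.
rewrite !rformBr !rformZr [rform v x]rformC xv -[rform v v]/(quad Q v).
rewrite -[rform x x]/(quad Q x).
have := hQ.2 v v0; set a := quad Q v; set b := quad Q x; set c := x i 0.
move=> a0 le0; rewrite -subr_ge0 -(pmulr_rge0 _ a0); lra.
Qed.

(** As the form bounds the coordinates, only finitely many vectors have a value below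
    a given one. *)
Lemma quadZ_argmin (P : 'cV[int]_g -> Prop) : (exists x, P x) ->
  exists2 x, P x & forall y, P y -> quadZ Q x <= quadZ Q y.
Proof.
case=> x0 Px0; pose N i := Num.bound (sval (cid2 (posdef_coord_bound i)) * quadZ Q x0).
pose M := (\sum_i N i)%N.
have small y i : quadZ Q y <= quadZ Q x0 -> (absz (y i 0%R) <= M)%N.
  move=> le_y; apply: (@leq_trans (N i)); last by rewrite /M (bigD1 i) //= leq_addr.
  rewrite /N; case: cid2 => K K0 /= bndK; set r := K * _.
  have r0 : 0 <= r by rewrite mulr_ge0 ?quadZ_ge0.
  have := bndK (realvec y); rewrite mxE -/(quadZ Q y) => le_K.
  have le_sqr : (absz (y i 0%R))%:R <= (y i 0 ^+ 2)%:~R :> R.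
    by rewrite pmulrn ler_int; nia.
  have := le_lt_trans (le_trans le_sqr _) (archi_boundP r0).
  rewrite rmorphXn /= ltr_nat => lt_r; apply/ltnW/lt_r.
  by apply: le_trans le_K _; rewrite ler_wpM2l.
pose vec (f : {ffun 'I_g -> 'I_(M + M).+1}) : 'cV[int]_g :=
  \col_i ((f i : nat)%:Z - M%:Z).
have vecP y : quadZ Q y <= quadZ Q x0 -> exists f, y = vec f.
  move=> le_y; exists [ffun i => inord (absz (y i 0%R + M%:Z)%R)].
  apply/matrixP=> i j; rewrite ord1 mxE ffunE inordK; last first.
    by have := small y i le_y; lia.
  by have := small y i le_y; lia.
have [f0 f0x] := vecP _ (lexx _).
pose good f := `[< P (vec f) >].
have good0 : good f0 by apply/asboolP; rewrite -f0x.
case: (@arg_minP _ R _ f0 good (fun f => quadZ Q (vec f)) good0) => f /asboolP Pf minf.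
exists (vec f) => // y Py.
have [le_y|/ltW le_y] := leP (quadZ Q y) (quadZ Q x0).
  have [f' yf'] := vecP y le_y; rewrite yf'; apply: minf.
  by apply/asboolP; rewrite -yf'.
by apply: le_trans le_y; rewrite f0x; apply: minf.
Qed.
End Form.

(** * Binary matroids and dual families *)

Lemma ex_matroid_basis (T : finType) (M : matroid T) (X : {set T}) :
  indep M X -> exists2 B : {set T}, X \subset B & matroid_basis M B.
Proof.
move=> indX; pose P (Y : {set T}) := `[< indep M Y >].
have [B /maxsetP[/asboolP indB maxB] subXB] :=
  @maxset_exists _ P X (introT (asboolP _) indX).
exists B => //; split=> // Y indY subBY; apply: maxB => //; exact/asboolP.
Qed.

Section Bases.
Variable g : nat.
Implicit Types (E B X D : {set 'cV['F_2]_g}) (e eta alpha : 'cV['F_2]_g).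

Lemma F2_sum_scale X (c : 'cV['F_2]_g -> 'F_2) :
  \sum_(e in X) c e *: e = \sum_(e in [set e in X | c e != 0]) e.
Proof.
rewrite (bigID (fun e => c e != 0)) /= [X in _ + X]big1 ?addr0.
  rewrite [RHS](eq_bigl (fun e => (e \in X) && (c e != 0))) => [|e]; last by rewrite inE.
  by apply: eq_bigr => e /andP[_ /F2_neq0->]; rewrite scale1r.
by move=> e /andP[_ /negPn/eqP->]; rewrite scale0r.
Qed.

Lemma F2_free_setP X :
  free (enum X) <-> (forall D, D \subset X -> \sum_(e in D) e = 0 -> D = set0).
Proof.
split=> [freeX D subDX sumD|indX].
  apply/setP=> e; rewrite in_set0; apply/negP => eD.
  have eX := subsetP subDX e eD.
  have ltX : (index e (enum X) < size (enum X))%N by rewrite index_mem mem_enum.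
  have := @freeP _ _ _ (in_tuple (enum X)) freeX
    (fun i => ((enum X)`_i \in D)%:R) _ (Ordinal ltX).
  rewrite /= nth_index ?mem_enum // eD => /(_ _)/eqP.
  rewrite oner_eq0 => /(_ _)/negP; apply=> //.
  rewrite -[RHS]sumD -(big_mkord xpredT (fun i => ((enum X)`_i \in D)%:R *: (enum X)`_i)).
  rewrite -(big_nth 0 xpredT (fun f => (f \in D)%:R *: f)) big_enum /=.
  rewrite F2_sum_scale; apply: eq_bigl => f; rewrite inE.
  case: (boolP (f \in D)) => [/(subsetP subDX)->|_] //=.
  by rewrite andbF.
apply/(@freeP _ _ _ (in_tuple (enum X)) : reflect _ (free (enum X))) => k sumk i.
pose k' n : 'F_2 := oapp k 0 (insub n).
have k'E (j : 'I_(size (enum X))) : k' j = k j by rewrite /k' valK.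
pose c e := k' (index e (enum X)).
have c0 : [set e in X | c e != 0] = set0.
  apply: indX; first by apply/subsetP=> e; rewrite inE => /andP[].
  rewrite -F2_sum_scale -big_enum /= (big_nth 0) big_mkord -[RHS]sumk.
  by apply: eq_bigr => j _; rewrite /c index_uniq ?enum_uniq // k'E.
have := in_set0 (enum X)`_i; rewrite -c0 inE -mem_enum mem_nth //=.
by rewrite /c index_uniq ?enum_uniq // k'E => /negbFE/eqP.
Qed.

(** That [E] spans the dual space, in the form in which it is used: its elements have
    no common zero. *)
Definition spanning E := forall alpha, (forall e, e \in E -> ~~ bit e alpha) -> alpha = 0.

Definition dual_family E (b alpha : 'I_g -> 'cV['F_2]_g) :=
  (forall i, b i \in E) /\ forall i j, bit (b i) (alpha j) = (i == j).

Section DualFamily.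
Variables (E : {set 'cV['F_2]_g}) (b alpha : 'I_g -> 'cV['F_2]_g).
Hypothesis dual_ba : dual_family E b alpha.

Let Mb : 'M['F_2]_g := \matrix_(i, j) b i j 0.
Let Ma : 'M['F_2]_g := \matrix_(i, j) alpha j i 0.

Let MbMa : Mb *m Ma = 1%:M.
Proof.
apply/matrixP=> i j; rewrite !mxE -dual_ba.2 -pairing_bit pairingE.
by apply: eq_bigr => k _; rewrite !mxE.
Qed.

Lemma dual_family_expand eta : eta = \sum_k pairing (b k) eta *: alpha k.
Proof.
apply/matrixP=> i j; rewrite ord1 summxE -[eta in LHS]mul1mx -(mulmx1C MbMa).
rewrite -mulmxA mxE; apply: eq_bigr => k _; rewrite !mxE mulrC pairingE.
by congr (_ * _); apply: eq_bigr => l _; rewrite !mxE.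
Qed.

Lemma dual_family_inj eta eta' :
  (forall k, bit (b k) eta = bit (b k) eta') -> eta = eta'.
Proof.
move=> eq_eta; rewrite [LHS]dual_family_expand [RHS]dual_family_expand.
by apply: eq_bigr => k _; rewrite !pairing_bit eq_eta.
Qed.

Lemma dual_family_eq0 eta : (forall k, ~~ bit (b k) eta) -> eta = 0.
Proof. by move=> eta0; apply: dual_family_inj => k; rewrite bit0 (negPf (eta0 k)). Qed.

Lemma dual_family_neq0 k : alpha k != 0.
Proof.
by apply: contraTneq isT => ak; have := dual_ba.2 k k; rewrite ak bit0 eqxx.
Qed.

Lemma dual_family_injective : injective b.
Proof.
move=> i j bij; have := dual_ba.2 i j; rewrite bij dual_ba.2 eqxx.
by move/esym/eqP.
Qed.

Lemma dual_family_functional e f :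
  (forall k, bit e (alpha k) = bit f (alpha k)) -> e = f.
Proof.
move=> eq_ef; apply: pairing_inj => eta; rewrite [eta]dual_family_expand.
by rewrite !pairing_sumr; apply: eq_bigr => k _; rewrite !pairingZr !pairing_bit eq_ef.
Qed.

End DualFamily.

(** The elements of [B] have no common zero either, because by maximality they
    generate [E].  So the matrix of their coordinates is square and invertible, and
    the columns of its inverse are dual to [B]. *)
Lemma matroid_basis_dual E B : spanning E -> matroid_basis (binary_matroid E) B ->
  exists b (alpha : 'I_g -> 'cV['F_2]_g),
    dual_family E b alpha /\ (forall e, e \in B <-> exists i, e = b i).
Proof.
move=> spanE [[/= subBE /F2_free_setP indB] maxB].
pose M : 'M['F_2]_(#|B|, g) := \matrix_(i, j) (enum_val i : 'cV_g) j 0.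
have freeM : row_free M.
  rewrite -kermx_eq0; apply/eqP/row_matrixP => k; rewrite row0.
  have : row k (kermx M) *m M = 0 by rewrite -row_mul mulmx_ker row0.
  move: (row k _) => u uM; apply/matrixP=> i j; rewrite ord1 {i} mxE.
  pose c e := \sum_(l | enum_val l == e) u 0 l.
  have cE l : c (enum_val l) = u 0 l.
    rewrite /c (bigD1 l) //= big1 ?addr0 // => l'.
    by rewrite (inj_eq enum_val_inj) => /andP[/eqP->]; rewrite eqxx.
  have c0 : [set e in B | c e != 0] = set0.
    apply: indB; first by apply/subsetP=> e; rewrite inE => /andP[].
    rewrite -F2_sum_scale big_enum_val /=; apply/matrixP=> i j'.
    move/matrixP/(_ 0 i): uM; rewrite !mxE ord1 summxE => uM.
    by rewrite -[RHS]uM; apply: eq_bigr => l _; rewrite cE !mxE.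
  have := in_set0 (enum_val j); rewrite -c0 inE enum_valP cE /=.
  by move/negbFE/eqP.
have freeMT : row_free M^T.
  rewrite -kermx_eq0; apply/eqP/row_matrixP => k; rewrite row0.
  have : row k (kermx M^T) *m M^T = 0 by rewrite -row_mul mulmx_ker row0.
  move: (row k _) => u uM; suff: u^T = 0 by move/(congr1 trmx); rewrite trmxK trmx0.
  have uB e : e \in B -> pairing e u^T = 0.
    move=> eB; move/matrixP/(_ 0 (enum_rank_in eB e)): uM; rewrite !mxE => uM.
    rewrite -[RHS]uM pairingE; apply: eq_bigr => i _; rewrite !mxE mulrC.
    by rewrite enum_rankK_in.
  apply: spanE => e eE; apply/bitP; have [/uB//|neB] := boolP (e \in B).
  have [indD|] := pselect (forall D, D \subset e |: B -> \sum_(f in D) f = 0 -> D = set0).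
    have : e \in e |: B by rewrite setU11.
    rewrite (maxB (e |: B)) ?(negPf neB) ?subsetUr //; split; last exact/F2_free_setP.
    by rewrite subUset sub1set eE.
  move/existsNP=> [D] /not_implyP[subD] /not_implyP[sumD D0].
  have eD : e \in D.
    apply/negPn/negP => neD; apply/D0/indB => //; apply/subsetP => f fD.
    by have := subsetP subD f fD; rewrite !inE => /predU1P[fe|//]; rewrite -fe fD in neD.
  move: sumD; rewrite (big_setD1 e) //= => /F2_vec_add_eq0->.
  rewrite pairing_suml big1 // => f; rewrite !inE => /andP[fe fD]; apply: uB.
  by have := subsetP subD f fD; rewrite !inE (negPf fe).
have cardB : #|B| = g.
  by move: freeM freeMT; rewrite /row_free mxrank_tr => /eqP-> /eqP.
pose b i : 'cV['F_2]_g := enum_val (cast_ord (esym cardB) i).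
pose N : 'M['F_2]_g := \matrix_(i, j) b i j 0.
have unitN : N \in unitmx.
  rewrite -row_free_unit -kermx_eq0; apply/eqP/row_matrixP => k; rewrite row0.
  have : row k (kermx N) *m N = 0 by rewrite -row_mul mulmx_ker row0.
  move: (row k _) => u uN; have uM : castmx (erefl, esym cardB) u *m M = 0.
    apply/matrixP=> i j; move/matrixP/(_ i j): uN; rewrite !mxE => uN.
    rewrite -[RHS]uN (reindex (cast_ord (esym cardB))) /=; last first.
      by exists (cast_ord cardB) => l _; rewrite ?cast_ordK ?cast_ordKV.
    apply: eq_bigr => l _; rewrite castmxE !mxE /= cast_ord_id; congr (u _ _ * _).
    exact: cast_ordK.
  have u0 : castmx (erefl, esym cardB) u = 0.
    by apply: (row_free_inj freeM); rewrite mul0mx.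
  by rewrite -(castmxK erefl (esym cardB) u) u0 castmx_const.
exists b, (fun j => col j (invmx N)); split; last first.
  move=> e; split=> [eB|[i ->]]; last exact: enum_valP.
  exists (cast_ord cardB (enum_rank_in eB e)).
  by rewrite /b cast_ordK enum_rankK_in.
split=> [i|i j]; first exact: (subsetP subBE _ (enum_valP _)).
rewrite /bit pairingE; have /matrixP/(_ i j) := mulmxV unitN.
rewrite !mxE => NV; rewrite (_ : \sum_i _ = (i == j)%:R); last first.
  by rewrite -[RHS]NV; apply: eq_bigr => k _; rewrite !mxE.
by case: (i == j); rewrite ?eqxx ?oner_eq0.
Qed.

Lemma ex_dual_family E : spanning E ->
  exists b (alpha : 'I_g -> 'cV['F_2]_g), dual_family E b alpha.
Proof.
move=> spanE; have [|B _ basisB] := @ex_matroid_basis _ (binary_matroid E) set0.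
  split; first exact: sub0set.
  by apply/F2_free_setP => D; rewrite subset0 => /eqP.
have [b [alpha [dual_ba _]]] := matroid_basis_dual spanE basisB.
by exists b, alpha.
Qed.

End Bases.

(** * Forms with nonnegative weights are sums of squares of covectors *)

Local Opaque quadZ bform bit class2.

Lemma sum4_eq (R : realType) (q1 q2 q3 q4 w1 w2 w3 w4 s t : R) :
  w1 <= q1 -> w2 <= q2 -> w3 <= q3 -> w4 <= q4 -> 0 <= t ->
  q1 + q2 + q3 + q4 = s -> w1 + w2 + w3 + w4 = s + t ->
  [/\ t = 0, q1 = w1, q2 = w2, q3 = w3 & q4 = w4].
Proof. by move=> *; split; lra. Qed.

Lemma sum2_eq (R : realType) (q1 q2 u v : R) :
  u + v <= q2 -> u + v <= q1 -> q1 + q2 = 2 * u + 2 * v ->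
  q1 = u + v /\ q2 = u + v.
Proof. by move=> *; split; lra. Qed.

Section Weights.
Variables (R : realType) (g : nat) (Q : 'M[R]_g).
Hypothesis hQ : posdef Q.
Variables (E : {set 'cV['F_2]_g}) (lambda : 'cV['F_2]_g -> R).
Hypothesis lambda_gt0 : forall e, e \in E -> 0 < lambda e.
Implicit Types (x y t h : 'cV[int]_g) (alpha beta eta gamma e : 'cV['F_2]_g).

Definition weight alpha : R := \sum_(e in E) lambda e * (bit e alpha)%:R.

Variable r : 'cV['F_2]_g -> 'cV[int]_g.
Hypothesis r_shortest : forall alpha, shortest_representative Q alpha (r alpha).
Hypothesis r_weight : forall alpha, quadZ Q (r alpha) = weight alpha.

Definition shortest x := quadZ Q x = weight (class2 x).

Lemma class2_rep alpha : class2 (r alpha) = alpha.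
Proof. by case: (r_shortest alpha). Qed.

Lemma shortest_rep alpha : shortest (r alpha).
Proof. by rewrite /shortest class2_rep r_weight. Qed.

Lemma weight_le x : weight (class2 x) <= quadZ Q x.
Proof. by rewrite -r_weight; case: (r_shortest (class2 x)) => _; apply. Qed.

Lemma weight0 : weight 0 = 0.
Proof. by rewrite /weight big1 // => e _; rewrite bit0 mulr0. Qed.

Lemma rep_neq0 alpha : alpha != 0 -> r alpha != 0.
Proof. by move=> a0; apply: class2_neq0; rewrite class2_rep. Qed.

Lemma shortest0 x : class2 x = 0 -> shortest x -> x = 0.
Proof. by move=> x0 sx; apply: (quadZ_eq0 hQ); rewrite sx x0 weight0. Qed.

Lemma spanning_support : spanning E.
Proof.
move=> alpha a0; apply/eqP/negPn/negP => /rep_neq0/(quadZ_gt0 hQ).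
rewrite r_weight /weight big1 ?ltxx // => e eE.
by rewrite (negPf (a0 e eE)) mulr0.
Qed.

Lemma weight_quadrangle a b c :
  weight c + weight (c + (a + b)) + weight (c + b) + weight (c + a) =
  weight a + weight b + weight (a + b) +
  \sum_(e in E) lambda e * (4 * [&& ~~ bit e a, ~~ bit e b & bit e c]%:R).
Proof.
rewrite /weight -!big_split /=; apply: eq_bigr => e _.
rewrite !(bitD e) -!mulrDr; congr (_ * _).
by move: (bit e a) (bit e b) (bit e c) => [] [] [] /=; lra.
Qed.

Lemma weightE a : weight a = \sum_(e in E) lambda e * (bit e a)%:R.
Proof. by []. Qed.

Lemma weightD a b :
  weight (a + b) =
  weight a + weight b - 2 * \sum_(e in E) lambda e * (bit e a && bit e b)%:R.
Proof.
rewrite /weight mulr_sumr -big_split -sumrB /=; apply: eq_bigr => e _.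
by rewrite bitD; move: (bit e a) (bit e b) => [] [] /=; lra.
Qed.

Lemma weight_triple a b c :
  weight a + weight b + weight c
    - 2 * (\sum_(e in E) lambda e * (bit e a && bit e b)%:R)
    - 2 * (\sum_(e in E) lambda e * (bit e a && bit e c)%:R)
    - 2 * (\sum_(e in E) lambda e * (bit e b && bit e c)%:R) =
  weight (a + b + c) -
  \sum_(e in E) lambda e * (4 * [&& bit e a, bit e b & bit e c]%:R).
Proof.
rewrite /weight !mulr_sumr -!big_split -!sumrB /=; apply: eq_bigr => e _.
by rewrite !bitD; move: (bit e a) (bit e b) (bit e c) => [] [] [] /=; lra.
Qed.

Local Opaque weight.

(** The four halves [h], [h - t], [h - y], [h - x] of the vectors
    [x + y + t], ..., [- x + y + t] have the same total value as [x], [y] and [t].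
    They represent four classes whose total weight is at least as large, an
    element [e] of [E] contributing too much only if it vanishes on [x] and [y]
    but not on [h].  So all the inequalities are equalities. *)
Lemma shortest_halves x y t h :
  shortest x -> shortest y -> shortest t -> x + y + t = h + h ->
  [/\ forall e, e \in E -> ~~ bit e (class2 x) -> ~~ bit e (class2 y) ->
        ~~ bit e (class2 h),
      shortest h, shortest (h - t), shortest (h - y) & shortest (h - x)].
Proof.
move=> sx sy st hE.
have qsum : quadZ Q h + quadZ Q (h - t) + quadZ Q (h - y) + quadZ Q (h - x) =
    quadZ Q x + quadZ Q y + quadZ Q t.
  have tE : t = h + h - x - y.
    by rewrite -hE; apply/matrixP=> i j; rewrite !mxE; ring.
  rewrite tE !quadZE // !bformE // (bformC hQ x h) (bformC hQ y h) (bformC hQ y x).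
  ring.
have ct : class2 t = class2 x + class2 y.
  apply/esym/F2_vec_add_eq0; rewrite -!class2D hE class2D; exact: F2_vec_addxx.
set a := class2 x in ct *; set b := class2 y in ct *; set c := class2 h.
have le1 := weight_le h; have le2 := weight_le (h - t).
have le3 := weight_le (h - y); have le4 := weight_le (h - x).
rewrite /shortest -/a -/b in sx sy st.
pose bad e := lambda e * (4 * [&& ~~ bit e a, ~~ bit e b & bit e c]%:R).
have wsum : weight c + weight (class2 (h - t)) + weight (class2 (h - y))
    + weight (class2 (h - x)) =
    weight a + weight b + weight (class2 t) + \sum_(e in E) bad e.
  have -> : class2 (h - t) = c + (a + b) by rewrite class2B ct.
  have -> : class2 (h - y) = c + b by rewrite class2B.
  have -> : class2 (h - x) = c + a by rewrite class2B.
  by rewrite ct; apply: weight_quadrangle.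
have bad_ge0 e : e \in E -> 0 <= bad e.
  by move=> /lambda_gt0/ltW l0; rewrite !mulr_ge0 ?ler0n.
have sum_ge0 : 0 <= \sum_(e in E) bad e by apply: sumr_ge0.
have qsum' : quadZ Q h + quadZ Q (h - t) + quadZ Q (h - y) + quadZ Q (h - x) =
    weight a + weight b + weight (class2 t).
  by rewrite -sx -sy -st.
have [sum0 sh sht shy shx] := sum4_eq le1 le2 le3 le4 sum_ge0 qsum' wsum.
split; [|exact: sh|exact: sht|exact: shy|exact: shx].
move=> e eE nx ny; apply/negP => nc.
move/eqP: sum0; rewrite psumr_eq0 // => /allP/(_ e)/(_ _)/implyP.
rewrite mem_index_enum /bad nx ny nc => /(_ isT eE); rewrite mulf_eq0.
by rewrite (gt_eqF (lambda_gt0 eE)) /= mulr1 pnatr_eq0.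
Qed.

(** If nothing but the span of the two classes is killed by the elements of [E]
    which vanish on both, then one of the four halves is a shortest vector of the
    zero class, hence zero. *)
Lemma shortest_sum x y t :
  shortest x -> shortest y -> shortest t -> class2 t = class2 x + class2 y ->
  (forall eta, (forall e, e \in E -> ~~ bit e (class2 x) -> ~~ bit e (class2 y) ->
      ~~ bit e eta) ->
    [\/ eta = 0, eta = class2 x, eta = class2 y | eta = class2 x + class2 y]) ->
  [\/ t = x + y, t = x - y, t = - (x - y) | t = - (x + y)].
Proof.
move=> sx sy st ct flat.
have /class2_half[h hE] : class2 (x + y + t) = 0 by rewrite !class2D ct F2_vec_addxx.
have [noE sh sht shy shx] := shortest_halves sx sy st hE.
have tE : t = h + h - x - y by rewrite -hE; apply/matrixP=> i j; rewrite !mxE; ring.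
have [h0|hx|hy|hxy] := flat _ noE.
- by constructor 4; rewrite tE (shortest0 h0 sh) !add0r opprD.
- have : class2 (h - x) = 0 by rewrite class2B hx F2_vec_addxx.
  move/shortest0/(_ shx)/eqP; rewrite subr_eq0 => /eqP hxE.
  by constructor 2; rewrite tE hxE addrK.
- have : class2 (h - y) = 0 by rewrite class2B hy F2_vec_addxx.
  move/shortest0/(_ shy)/eqP; rewrite subr_eq0 => /eqP hyE.
  by constructor 3; rewrite tE hyE opprB [y + y - x]addrAC addrK.
have : class2 (h - t) = 0 by rewrite class2B ct hxy F2_vec_addxx.
move/shortest0/(_ sht)/eqP; rewrite subr_eq0 => /eqP htE.
by constructor 1; apply: (addIr t); rewrite hE htE.
Qed.


Section DualFamilyForm.
Variables b alpha : 'I_g -> 'cV['F_2]_g.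
Hypothesis dual_ba : dual_family E b alpha.

Let x i := r (alpha i).
Let overlap i j : R := \sum_(e in E) lambda e * (bit e (alpha i) && bit e (alpha j))%:R.
Let sgn i j : int := if 0 <= bform Q (x i) (x j) then 1 else -1.

Lemma dual_family_flat2 i j eta : i != j ->
  (forall e, e \in E -> ~~ bit e (alpha i) -> ~~ bit e (alpha j) -> ~~ bit e eta) ->
  [\/ eta = 0, eta = alpha i, eta = alpha j | eta = alpha i + alpha j].
Proof.
move=> ij flat; have off k : k != i -> k != j -> bit (b k) eta = false.
  move=> ki kj; apply/negbTE/(flat _ (dual_ba.1 k)); rewrite dual_ba.2.
    by rewrite (negPf ki).
  by rewrite (negPf kj).
have main eta' : bit (b i) eta = bit (b i) eta' -> bit (b j) eta = bit (b j) eta' ->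
    (forall k, k != i -> k != j -> bit (b k) eta' = false) -> eta = eta'.
  move=> ei ej ek; apply: (dual_family_inj dual_ba) => k.
  have [->//|ki] := eqVneq k i; have [->//|kj] := eqVneq k j.
  by rewrite off // ek.
have ji : (j == i) = false by rewrite eq_sym (negPf ij).
have [bi|/negPf bi] := boolP (bit (b i) eta); have [bj|/negPf bj] := boolP (bit (b j) eta);
  [constructor 4|constructor 2|constructor 3|constructor 1];
  apply: main; rewrite ?bit0 ?bitD ?dual_ba.2 ?eqxx ?(negPf ij) ?ji //.
- by move=> k /negPf ki /negPf kj; rewrite bitD !dual_ba.2 ki kj.
- by move=> k /negPf ki /negPf kj; rewrite !dual_ba.2 ki.
- by move=> k /negPf ki /negPf kj; rewrite !dual_ba.2 kj.
by move=> k _ _; rewrite bit0.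
Qed.

Lemma rep_sum i j : i != j ->
  [\/ r (alpha i + alpha j) = x i + x j, r (alpha i + alpha j) = x i - x j,
      r (alpha i + alpha j) = - (x i - x j) | r (alpha i + alpha j) = - (x i + x j)].
Proof.
move=> ij; apply: shortest_sum; rewrite ?class2_rep //; try exact: shortest_rep.
by move=> eta; apply: dual_family_flat2.
Qed.

Let overlap_ge0 i j : 0 <= overlap i j.
Proof. by apply: sumr_ge0 => e /lambda_gt0/ltW l0; rewrite mulr_ge0 ?ler0n. Qed.

(** As [r (alpha i + alpha j)] is [x i + x j] or [x i - x j] up to sign, its
    known value gives the product of [x i] and [x j] up to sign. *)
Lemma bform_overlap i j : bform Q (x i) (x j) = (sgn i j)%:~R * overlap i j.
Proof.
have [<-|ij] := eqVneq i j.
  rewrite /sgn -quadZE quadZ_ge0 // mul1r r_weight; apply: eq_bigr => e _.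
  by rewrite andbb.
have sq y z : quadZ Q (y + z) = quadZ Q y + quadZ Q z + 2 * bform Q y z.
  by rewrite !quadZE !bformE // (bformC hQ z y); ring.
have sqB y z : quadZ Q (y - z) = quadZ Q y + quadZ Q z - 2 * bform Q y z.
  by rewrite sq quadZN // !bformE // mulrN.
have qx k : quadZ Q (x k) = weight (alpha k) by apply: r_weight.
have : bform Q (x i) (x j) = overlap i j \/ bform Q (x i) (x j) = - overlap i j.
  have := r_weight (alpha i + alpha j); rewrite weightD -/(overlap i j).
  have solve (wi wj B v : R) : (wi + wj + 2 * B = wi + wj - 2 * v -> B = v \/ B = - v)
      /\ (wi + wj - 2 * B = wi + wj - 2 * v -> B = v \/ B = - v).
    by split=> ?; [right|left]; lra.
  by case: (rep_sum ij) => ->; rewrite ?quadZN // ?sqB ?sq !qx; apply solve.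
have := overlap_ge0 i j; rewrite /sgn; move: (bform _ _ _) (overlap _ _) => B v v0.
by case=> ->; case: ifP => [|/negbT]; rewrite ?mul1r ?mulN1r -?ltNge => ?; lra.
Qed.

(** If the sign rule failed, [x i - sgn i j x j - sgn i k x k] would be shorter than
    the minimum of its class, by at least [4 * lambda e]. *)
Lemma sgn_triangle e i j k : e \in E ->
  bit e (alpha i) -> bit e (alpha j) -> bit e (alpha k) ->
  sgn i j * sgn i k = sgn j k.
Proof.
move=> eE ei ej ek.
have sgn2 l m : sgn l m = 1 \/ sgn l m = -1 by rewrite /sgn; case: ifP; auto.
have [//|bad] : sgn i j * sgn i k = sgn j k \/ sgn i j * sgn i k = - sgn j k.
  by case: (sgn2 i j) => ->; case: (sgn2 i k) => ->; case: (sgn2 j k) => ->; auto.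
exfalso.
pose y := x i - sgn i j *: x j - sgn i k *: x k.
have ycl : class2 y = alpha i + alpha j + alpha k.
  have odd_sgn l m : (sgn l m)%:~R = 1 :> 'F_2.
    by case: (sgn2 l m) => ->; rewrite ?rmorph1 // intrN F2_opp.
  by rewrite !class2B !class2Z !odd_sgn !scale1r !class2_rep.
have := weight_le y; rewrite ycl.
have -> : quadZ Q y = weight (alpha i) + weight (alpha j) + weight (alpha k)
    - 2 * overlap i j - 2 * overlap i k - 2 * overlap j k.
  rewrite quadZE /y !bformE //.
  rewrite [bform Q (x j) (x i)]bformC // [bform Q (x k) (x i)]bformC //.
  rewrite [bform Q (x k) (x j)]bformC // -!quadZE !r_weight !bform_overlap.
  have sqr1 l m : (sgn l m)%:~R * (sgn l m)%:~R = 1 :> R.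
    by case: (sgn2 l m) => ->; rewrite -intrM.
  have bad' : (sgn i j)%:~R * (sgn i k)%:~R = - (sgn j k)%:~R :> R.
    by rewrite -intrM bad intrN.
  move: (sqr1 i j) (sqr1 i k) (sqr1 j k) bad'.
  move: (sgn i j)%:~R (sgn i k)%:~R (sgn j k)%:~R => u v w.
  move: (weight _) (weight _) (weight _) (overlap _ _) (overlap _ _) (overlap _ _).
  move=> wi wj wk oij oik ojk uu vv ww uv.
  ring: uu vv ww uv.
rewrite weight_triple leNgt => /negP; apply; rewrite ltrBlDr ltrDl.
rewrite (bigD1 e) //= ei ej ek ltr_wpDr ?mulr_gt0 ?lambda_gt0 ?ltr0n //.
by apply: sumr_ge0 => f /andP[/lambda_gt0/ltW f0 _]; rewrite !mulr_ge0 ?ler0n.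
Qed.

(** On the vectors where [e] does not vanish, the signs [sgn] are the products of the
    signs relative to one of these vectors, by [sgn_triangle]. *)
Definition signed_coeff e i : int :=
  if [pick k | bit e (alpha k)] is Some k then (bit e (alpha i))%:Z * sgn k i else 0.

Lemma signed_coeff_bit e i : (signed_coeff e i)%:~R = (bit e (alpha i))%:R :> 'F_2.
Proof.
rewrite /signed_coeff; case: pickP => [k ek|-> //].
rewrite intrM /sgn; case: ifP => _; rewrite ?intrN ?F2_opp mulr1; by case: bit.
Qed.

Lemma signed_coeff_mul e i j : e \in E ->
  signed_coeff e i * signed_coeff e j =
  (bit e (alpha i) && bit e (alpha j))%:Z * sgn i j.
Proof.
move=> eE; rewrite /signed_coeff; case: pickP => [k ek|->]; last by rewrite !mul0r.
case: (boolP (bit e (alpha i))) => ei; last by rewrite !mul0r.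
case: (boolP (bit e (alpha j))) => ej; last by rewrite !mul0r mulr0.
by rewrite !mul1r (sgn_triangle eE ek ei ej).
Qed.

Lemma quadZ_dual_family (n : 'I_g -> int) :
  quadZ Q (\sum_i n i *: x i) =
  \sum_(e in E) lambda e * (\sum_i signed_coeff e i * n i)%:~R ^+ 2.
Proof.
rewrite quadZE bform_suml //.
under eq_bigr => i _ do rewrite bform_sumr.
have eqe e : e \in E -> lambda e * (\sum_i signed_coeff e i * n i)%:~R ^+ 2 =
    \sum_i \sum_j (n i * n j)%:~R * ((sgn i j)%:~R *
      (lambda e * (bit e (alpha i) && bit e (alpha j))%:R)).
  move=> eE; rewrite expr2 -intrM mulr_suml rmorph_sum mulr_sumr; apply: eq_bigr => i _ /=.
  rewrite mulr_sumr rmorph_sum mulr_sumr; apply: eq_bigr => j _ /=.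
  rewrite mulrACA signed_coeff_mul // !intrM; case: (_ && _); ring.
rewrite (eq_bigr _ eqe) [RHS]exchange_big; apply: eq_bigr => i _ /=.
rewrite [RHS]exchange_big; apply: eq_bigr => j _ /=.
rewrite bformZl // bformZr // bform_overlap -!mulr_sumr intrM -/(overlap i j); ring.
Qed.

End DualFamilyForm.

Definition in_span (alpha : 'I_g -> 'cV['F_2]_g) y :=
  exists n : 'I_g -> int, y = \sum_i n i *: r (alpha i).

Section Span.
Variable alpha : 'I_g -> 'cV['F_2]_g.

Lemma in_spanD y z : in_span alpha y -> in_span alpha z -> in_span alpha (y + z).
Proof.
move=> [n ->] [m ->]; exists (fun i => n i + m i).
by rewrite -big_split; apply: eq_bigr => i _; rewrite scalerDl.
Qed.

Lemma in_spanZ k y : in_span alpha y -> in_span alpha (k *: y).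
Proof.
move=> [n ->]; exists (fun i => k * n i).
by rewrite scaler_sumr; apply: eq_bigr => i _; rewrite scalerA.
Qed.

Lemma in_spanN y : in_span alpha y -> in_span alpha (- y).
Proof. by rewrite -scaleN1r; apply: in_spanZ. Qed.

Lemma in_span_rep i : in_span alpha (r (alpha i)).
Proof.
exists (fun k => (k == i)%:Z); rewrite (bigD1 i) //= eqxx scale1r big1 ?addr0 //.
by move=> k /negPf->; rewrite scale0r.
Qed.

Lemma in_span_sum (I : finType) (F : I -> 'cV[int]_g) :
  (forall i, in_span alpha (F i)) -> in_span alpha (\sum_i F i).
Proof.
move=> spanF; apply: big_ind => [|y z|i _] //; last exact: in_spanD.
by exists (fun=> 0); rewrite big1 // => i _; rewrite scale0r.
Qed.

End Span.

(** An elementary class, spanning the common kernel of the elements of [E] that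
    vanish on it, is reached from any dual family by exchanges.  An exchange adds
    one vector of the family to others, so that [rep_sum] keeps the shortest
    vectors of the new family in the span of the old ones. *)
Lemma elementary_in_span m b (alpha : 'I_g -> 'cV['F_2]_g) gamma :
  dual_family E b alpha -> (#|[set i | bit (b i) gamma]| <= m)%N -> gamma != 0 ->
  (forall eta, (forall e, e \in E -> ~~ bit e gamma -> ~~ bit e eta) ->
    eta = 0 \/ eta = gamma) ->
  in_span alpha (r gamma).
Proof.
elim: m b alpha => [|m IHm] b alpha dual_ba card_m gamma0 flat.
  case/eqP: gamma0; apply: (dual_family_eq0 dual_ba) => k; apply/negP => bk.
  by move: card_m; rewrite leqn0 cards_eq0 => /eqP/setP/(_ k); rewrite !inE bk.
have [[i ->]|notin] := pselect (exists i, gamma = alpha i); first exact: in_span_rep.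
have [i0 bi0] : exists i0, bit (b i0) gamma.
  apply: contrapT => nob; case/eqP: gamma0; apply: (dual_family_eq0 dual_ba) => k.
  by apply/negP => bk; apply: nob; exists k.
have [e0 [e0E e0g e0a]] : exists e0, [/\ e0 \in E, ~~ bit e0 gamma & bit e0 (alpha i0)].
  apply: contrapT => noe; have [|a0|ag] := flat (alpha i0).
  - move=> e eE eg; apply/negP => ea; apply: noe; by exists e.
  - by have := dual_family_neq0 dual_ba i0; rewrite a0 eqxx.
  by apply: notin; exists i0.
pose b' k := if k == i0 then e0 else b k.
pose alpha' k :=
  if (k != i0) && bit e0 (alpha k) then alpha k + alpha i0 else alpha k.
have dual' : dual_family E b' alpha'.
  split=> [k|k j]; first by rewrite /b'; case: eqP => _ //; apply: dual_ba.1.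
  rewrite /b' /alpha'; have [->|ki] := eqVneq k i0.
    have [->|ji] := eqVneq j i0; first by rewrite /= e0a ?eqxx.
    by case: (boolP (bit e0 (alpha j))) => [ej|/negPf//]; rewrite bitD ej e0a.
  by case: ifP => _; rewrite ?bitD !dual_ba.2 // (negPf ki) addbF.
have {}card_m : (#|[set i | bit (b' i) gamma]| <= m)%N.
  rewrite -ltnS; apply: leq_trans card_m; apply: proper_card; apply/properP; split.
    apply/subsetP=> k; rewrite !inE /b'; have [_|_] := eqVneq k i0; last exact.
    by rewrite (negPf e0g).
  by exists i0; rewrite !inE /b' ?eqxx.
have [n ->] := IHm b' alpha' dual' card_m gamma0 flat.
apply: in_span_sum => k; apply: in_spanZ; rewrite /alpha'.
case: ifP => [/andP[ki _]|_]; last exact: in_span_rep.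
have spank := in_span_rep alpha k; have spani := in_spanN (in_span_rep alpha i0).
case: (rep_sum dual_ba ki) => ->; rewrite ?opprB ?opprD.
- by apply: in_spanD => //; apply: in_span_rep.
- exact: in_spanD.
- by apply: in_spanD; [apply: in_span_rep | apply: in_spanN].
by apply: in_spanD => //; apply: in_spanN.
Qed.

(** A vector outside the span with least value is, up to sign, the only shortest
    vector of its class [gamma]: from another one [y] the halves of [x + y] and
    [x - y] would be shorter.  So [gamma] is not a sum of two classes of disjoint
    supports, which makes it elementary. *)
Lemma dual_family_span b (alpha : 'I_g -> 'cV['F_2]_g) :
  dual_family E b alpha -> forall y, in_span alpha y.
Proof.
move=> dual_ba y0; apply: contrapT => noy0.
have [x nox minx] := @quadZ_argmin _ _ Q hQ (fun y => ~ in_span alpha y) (ex_intro _ y0 noy0).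
have lt_span y : quadZ Q y < quadZ Q x -> in_span alpha y.
  by move=> lt_y; apply: contrapT => /minx; rewrite leNgt lt_y.
have uniq_x y : class2 y = class2 x -> quadZ Q y <= quadZ Q x -> y = x \/ y = - x.
  move=> cy le_y.
  have /class2_half[u xyu] : class2 (x + y) = 0 by rewrite class2D cy F2_vec_addxx.
  have [u0|u0] := eqVneq u 0.
    by right; apply/eqP; rewrite -addr_eq0 addrC xyu u0 addr0.
  pose v := x - u; have xE : x = u + v by rewrite addrC subrK.
  have yE : y = u - v by apply: (addrI x); rewrite xyu {1}xE addrACA addrN addr0.
  have [v0|v0] := eqVneq v 0; first by left; rewrite yE [RHS]xE v0 subr0 addr0.
  exfalso; suff: in_span alpha x by [].
  have := quadZ_parallelogram hQ u v; rewrite -xE -yE => para.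
  have lt_u := quadZ_gt0 hQ u0; have lt_v := quadZ_gt0 hQ v0.
  have halves (qu qv qx qy : R) : qx + qy = 2 * qu + 2 * qv -> qy <= qx ->
    0 < qu -> 0 < qv -> qu < qx /\ qv < qx by move=> *; split; lra.
  have [lt_ux lt_vx] := halves _ _ _ _ para le_y lt_u lt_v.
  by rewrite xE; apply: in_spanD; apply: lt_span.
have x0 : x != 0.
  apply: contra_not_neq nox => ->; exists (fun=> 0).
  by rewrite big1 // => i _; rewrite scale0r.
pose gamma := class2 x.
have gamma0 : gamma != 0.
  apply: contra_neq x0 => cx; have [|||/eqP] := uniq_x 0.
  - by rewrite class2_0.
  - by rewrite quadZ0 // quadZ_ge0.
  - by move=> <-.
  by rewrite eq_sym oppr_eq0 => /eqP.
have xr : r gamma = x \/ r gamma = - x.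
  by apply: uniq_x; rewrite ?class2_rep // r_weight weight_le.
have qx : quadZ Q x = weight gamma.
  by rewrite -r_weight; case: xr => ->; rewrite ?quadZN.
suff: in_span alpha (r gamma).
  by case: xr => -> // /in_spanN; rewrite opprK => /nox.
apply: (elementary_in_span dual_ba (leqnn _) gamma0) => eta flat.
apply: contrapT => /not_orP[/eqP eta0 /eqP etag].
pose zeta := gamma + eta.
have zeta0 : zeta != 0 by apply: contra_neq etag => /F2_vec_add_eq0.
have zetaE : eta + zeta = gamma by rewrite /zeta addrCA F2_vec_addxx addr0.
have wsum : weight gamma = weight eta + weight zeta.
  rewrite -{1}zetaE weightD big1 ?mulr0 ?subr0 // => e eE.
  rewrite /zeta bitD; have [ge|ge] := boolP (bit e gamma).
    by case: (bit e eta); rewrite mulr0.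
  by rewrite (negPf (flat e eE ge)) mulr0.
have qpm : quadZ Q (r eta + r zeta) = weight gamma /\ quadZ Q (r eta - r zeta) = weight gamma.
  have := quadZ_parallelogram hQ (r eta) (r zeta); rewrite !r_weight.
  have := weight_le (r eta + r zeta); have := weight_le (r eta - r zeta).
  rewrite class2B class2D !class2_rep zetaE wsum.
  exact: sum2_eq.
have eq_x y : class2 y = gamma -> quadZ Q y = weight gamma -> y = x \/ y = - x.
  by move=> cy qy; apply: uniq_x; rewrite // qx qy.
have rz0 := rep_neq0 zeta0; have re0 := rep_neq0 eta0.
have selfN (v : 'cV[int]_g) : v = - v -> v = 0.
  move=> /matrixP vN; apply/matrixP=> i j; have := vN i j; rewrite !mxE.
  by move: (v i j) => n nn; lia.
have same : r eta + r zeta = r eta - r zeta -> False.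
  by move/addrI/selfN/eqP; rewrite (negPf rz0).
have opp : r eta + r zeta = - (r eta - r zeta) -> False.
  by rewrite opprB addrC => /addrI/selfN/eqP; rewrite (negPf re0).
have [] := eq_x (r eta + r zeta); rewrite ?class2D ?class2_rep ?qpm.1 // => plus;
have [] := eq_x (r eta - r zeta); rewrite ?class2B ?class2_rep ?qpm.2 // => minus.
- by apply: same; rewrite plus minus.
- by apply: opp; rewrite plus minus opprK.
- by apply: opp; rewrite plus minus.
by apply: same; rewrite plus minus.
Qed.

Lemma span_dual (alpha : 'I_g -> 'cV['F_2]_g) (c : 'I_g -> int) :
  (forall y, in_span alpha y) ->
  exists a, forall k, pairing a (r (alpha k)) = c k.
Proof.
move=> spanA; pose P : 'M[int]_g := \matrix_(i, j) r (alpha j) i 0.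
have [n nE] := choice (fun j => spanA (delta_mx j 0)).
pose N : 'M[int]_g := \matrix_(i, j) n j i.
have PN : P *m N = 1%:M.
  apply/matrixP=> i j; move/matrixP/(_ i 0): (nE j); rewrite summxE !mxE eqxx andbT => ->.
  by apply: eq_bigr => k _; rewrite !mxE mulrC.
exists (N^T *m \col_k c k) => k.
rewrite /pairing trmx_mul trmxK -mulmxA.
have -> : r (alpha k) = P *m delta_mx k 0.
  by apply/matrixP=> i j; rewrite -colE !mxE ord1.
rewrite (mulmxA N) (mulmx1C PN) mul1mx -colE !mxE //.
Qed.

(** Since the vectors of a dual family form a basis of the lattice, the linear forms
    of [quadZ_dual_family] are covectors. *)
Theorem sum_of_squares : exists a : 'cV['F_2]_g -> 'cV[int]_g,
  (forall e, e \in E -> class2 (a e) = e) /\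
  forall x, quadZ Q x = \sum_(e in E) lambda e * (pairing (a e) x)%:~R ^+ 2.
Proof.
have [b [alpha dual_ba]] := ex_dual_family spanning_support.
have spanA := dual_family_span dual_ba.
have [a aE] := choice (fun e => span_dual (signed_coeff alpha e) spanA).
exists a; split=> [e eE|x].
  apply: (dual_family_functional dual_ba) => k; rewrite -{1}(class2_rep (alpha k)).
  by rewrite bit_class2 aE signed_coeff_bit -pairing_bit.
have [n ->] := spanA x; rewrite (quadZ_dual_family dual_ba).
apply: eq_bigr => e _; congr (_ * _%:~R ^+ 2); rewrite pairing_sumr.
by apply: eq_bigr => i _; rewrite pairingZr aE mulrC.
Qed.

End Weights.

Local Opaque weight.

(** * The covectors of a sum of squares *)

Lemma inIntSpan_enum (T : finType) (V : zmodType) (A : {set T}) (f : T -> V) v :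
  inIntSpan [seq f b | b <- enum A] v <->
  exists n : T -> int, v = \sum_(b in A) f b *~ n b.
Proof.
have nthE (i : 'I_#|A|) : [seq f b | b <- enum A]`_i = f (enum_val i).
  by rewrite (nth_map (enum_default i)) -?cardE // /enum_val.
split=> [[n ->]|[n ->]].
  exists (fun b => \sum_(i | enum_val i == b) n i); rewrite [RHS]big_enum_val /=.
  apply: eq_bigr => i _; rewrite nthE; congr (_ *~ _).
  rewrite (bigD1 i) //= big1 ?addr0 // => j.
  by rewrite (inj_eq enum_val_inj) => /andP[/eqP->]; rewrite eqxx.
exists [ffun i => n (enum_val i)]; rewrite [LHS]big_enum_val /=.
by apply: eq_bigr => i _; rewrite nthE ffunE.
Qed.

Lemma sqr_int_le1 (n : int) (c : bool) : n ^+ 2 = c -> if c then n = 1 \/ n = -1 else n = 0.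
Proof. by case: c => n2; nia. Qed.

Section Covectors.
Variables (R : realType) (g : nat) (Q : 'M[R]_g).
Hypothesis hQ : posdef Q.
Variables (E : {set 'cV['F_2]_g}) (lambda : 'cV['F_2]_g -> R).
Hypothesis lambda_gt0 : forall e, e \in E -> 0 < lambda e.
Variable r : 'cV['F_2]_g -> 'cV[int]_g.
Hypothesis r_shortest : forall alpha, shortest_representative Q alpha (r alpha).
Hypothesis r_weight : forall alpha, quadZ Q (r alpha) = weight E lambda alpha.
Variable a : 'cV['F_2]_g -> 'cV[int]_g.
Hypothesis a_class : forall e, e \in E -> class2 (a e) = e.
Hypothesis a_squares :
  forall x, quadZ Q x = \sum_(e in E) lambda e * (pairing (a e) x)%:~R ^+ 2.

(** The weight of a class counts each of its odd coordinates once, so that a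
    shortest vector has coordinates [0] and [1] or [-1]. *)
Lemma covector_sqr alpha e : e \in E -> pairing (a e) (r alpha) ^+ 2 = (bit e alpha)%:Z.
Proof.
move=> eE; pose gap f : int := pairing (a f) (r alpha) ^+ 2 - (bit f alpha)%:Z.
have gap_ge0 f : f \in E -> 0 <= gap f.
  move=> fE; rewrite /gap subr_ge0; apply: le_trans (F2_int_sqr _).
  by rewrite -bit_class2 a_class // (class2_rep r_shortest).
have : \sum_(f in E) lambda f * (gap f)%:~R = 0.
  have := r_weight alpha; rewrite a_squares weightE => /eqP.
  rewrite -subr_eq0 -sumrB => /eqP {2}<-; apply: eq_bigr => f _.
  by rewrite intrB rmorphXn mulrBr.
move/eqP; rewrite psumr_eq0 => [/allP/(_ e)|f fE]; last first.
  by rewrite mulr_ge0 ?ler0z ?gap_ge0 // ltW ?lambda_gt0.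
rewrite mem_index_enum => /(_ isT)/implyP/(_ eE).
by rewrite mulf_eq0 (gt_eqF (lambda_gt0 eE)) intr_eq0 subr_eq0 => /eqP.
Qed.

Section Dual.
Variables b alpha : 'I_g -> 'cV['F_2]_g.
Hypothesis dual_ba : dual_family E b alpha.
Let x i := r (alpha i).

Lemma covector_dual i j : i != j -> pairing (a (b i)) (x j) = 0.
Proof.
move=> /negPf ij; have := covector_sqr (alpha j) (dual_ba.1 i).
by rewrite dual_ba.2 ij => /sqr_int_le1.
Qed.

Lemma covector_dual1 i : pairing (a (b i)) (x i) = 1 \/ pairing (a (b i)) (x i) = -1.
Proof.
have := covector_sqr (alpha i) (dual_ba.1 i).
by rewrite dual_ba.2 eqxx => /sqr_int_le1.
Qed.

Let span_x : forall y, in_span r alpha y.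
Proof. exact: (dual_family_span hQ lambda_gt0 r_shortest r_weight dual_ba). Qed.

Lemma covector_eq c c' : (forall i, pairing c (x i) = pairing c' (x i)) -> c = c'.
Proof.
move=> eq_c; apply: pairing_inj => y; have [n ->] := span_x y.
by rewrite !pairing_sumr; apply: eq_bigr => i _; rewrite !pairingZr eq_c.
Qed.

Lemma covector_expand c :
  c = \sum_i (pairing c (x i) * pairing (a (b i)) (x i)) *: a (b i).
Proof.
apply: covector_eq => j; rewrite pairing_suml (bigD1 j) //= big1 => [|i ij].
  by rewrite pairingZl addr0; case: (covector_dual1 j) => ->; lia.
by rewrite pairingZl (covector_dual ij) mulr0.
Qed.

Lemma vector_expand y :
  y = \sum_i (pairing (a (b i)) y * pairing (a (b i)) (x i)) *: x i.
Proof.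
have [n ->] := span_x y; apply: eq_bigr => i _; congr (_ *: _).
rewrite pairing_sumr (bigD1 i) //= big1 => [|j ji].
  by rewrite pairingZr addr0; case: (covector_dual1 i) => ->; lia.
by rewrite pairingZr covector_dual ?mulr0 // eq_sym.
Qed.

Lemma covector_primitive i : primitive (a (b i)).
Proof.
move=> k c abE; have := covector_dual1 i; rewrite abE pairingZl.
move: (pairing c _) => m km; have /eqP : (absz k * absz m = 1)%N.
  by rewrite -abszM; case: km => ->.
by rewrite muln_eq1 => /andP[/eqP k1 _]; rewrite -abszE k1.
Qed.

Lemma covector_kernel i y :
  pairing (a (b i)) y = 0 <-> exists n : 'I_g -> int, y = \sum_(k | k != i) n k *: x k.
Proof.
split=> [ay|[n ->]].
  exists (fun k => pairing (a (b k)) y * pairing (a (b k)) (x k)).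
  by rewrite {1}[y]vector_expand (bigD1 i) //= ay mul0r scale0r add0r.
by rewrite pairing_sumr big1 // => k ki; rewrite pairingZr covector_dual ?mulr0 // eq_sym.
Qed.

(** A covector vanishing on all vectors of the basis but one is a multiple of a
    covector dual to this basis. *)
Lemma covector_unique i c : primitive c ->
  (forall k, k != i -> pairing c (x k) = 0) -> c = a (b i) \/ c = - a (b i).
Proof.
move=> prim_c c0; have cE : c = (pairing c (x i) * pairing (a (b i)) (x i)) *: a (b i).
  rewrite {1}[c]covector_expand (bigD1 i) //= big1 ?addr0 // => k ki.
  by rewrite c0 // mul0r scale0r.
have := prim_c _ _ cE; move: (_ * _) cE => n -> n1.
have [->|->] : n = 1 \/ n = -1 by lia.
  by left; rewrite scale1r.
by right; rewrite scaleN1r.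
Qed.

End Dual.

(** A relation modulo 2 that contains no smaller one expresses an element [e0] through
    independent ones.  After extending these to a basis, the coefficients of [a e0] are
    up to sign its values at the shortest vectors of the dual family, hence [1] or [-1]
    where [e0] does not vanish and [0] elsewhere. *)
Lemma covector_relation (D : {set 'cV['F_2]_g}) : D \subset E -> \sum_(e in D) e = 0 ->
  exists eps : 'cV['F_2]_g -> int,
    (forall e, e \in D -> eps e = 1 \/ eps e = -1) /\ \sum_(e in D) eps e *: a e = 0.
Proof.
have [m] := ubnP #|D|; elim: m D => // m IHm D /ltnSE-leDm subDE sumD.
have [->|D0] := eqVneq D set0.
  by exists (fun=> 1); rewrite big_set0; split=> // e; rewrite inE.
have [[C [subCD C0 CD sumC]]|minD] := pselect (exists C : {set 'cV['F_2]_g},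
    [/\ C \subset D, C != set0, C != D & \sum_(e in C) e = 0]).
  have CI : D :&: C = C by apply/setIidPr.
  have sumDC : \sum_(e in D :\: C) e = 0.
    by move: sumD; rewrite (big_setID C) /= CI sumC add0r.
  have ltC : (#|C| < m)%N.
    by apply: leq_trans leDm; apply: proper_card; rewrite properEneq CD.
  have ltDC : (#|D :\: C| < m)%N.
    apply: leq_trans leDm; rewrite cardsD CI ltn_subrL card_gt0 C0.
    by rewrite card_gt0.
  have [eps1 [s1 r1]] := IHm C ltC (subset_trans subCD subDE) sumC.
  have [eps2 [s2 r2]] := IHm _ ltDC (subset_trans (subsetDl _ _) subDE) sumDC.
  exists (fun e => if e \in C then eps1 e else eps2 e); split=> [e eD|].
    by case: ifP => eC; [apply: s1 | apply: s2; rewrite inE eC].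
  rewrite (big_setID C) /= CI.
  rewrite (eq_bigr (fun e => eps1 e *: a e)) => [|e ->] //; rewrite r1 add0r.
  by rewrite -[RHS]r2; apply: eq_bigr => e; rewrite inE => /andP[/negPf->].
have [e0 e0D] := set0Pn _ D0; pose C := D :\ e0.
have sumC : e0 = \sum_(e in C) e.
  by move: sumD; rewrite (big_setD1 e0) //= => /F2_vec_add_eq0.
have indC : indep (binary_matroid E) C.
  split; first exact: subset_trans (subsetDl _ _) subDE.
  apply/F2_free_setP => X subXC sumX; apply/eqP/negPn/negP => X0; apply: minD.
  exists X; split=> //; first exact: subset_trans subXC (subsetDl _ _).
  by apply: contraTneq subXC => ->; rewrite subsetD1 e0D andbF.
have [B subCB basisB] := ex_matroid_basis indC.
have spanE := spanning_support hQ r_shortest r_weight.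
have [b [alpha [dual_ba memB]]] := matroid_basis_dual spanE basisB.
have injb := dual_family_injective dual_ba.
have bit_e0 i : bit e0 (alpha i) = (b i \in C).
  have sumb : pairing e0 (alpha i) = \sum_(e in C) (e == b i)%:R.
    rewrite {1}sumC pairing_suml; apply: eq_bigr => e eC.
    have [k ->] := (memB e).1 (subsetP subCB e eC).
    rewrite pairing_bit dual_ba.2; congr (_%:R); congr nat_of_bool.
    by apply/eqP/eqP => [->//|/injb].
  rewrite bitE sumb; have [biC|niC] := boolP (b i \in C).
    by rewrite (bigD1 (b i)) //= eqxx big1 => [|e /andP[_ /negPf->]] //; rewrite addr0.
  rewrite big1 ?eqxx // => e eC; case: eqP => // ei; by rewrite -ei eC in niC.
pose c i := pairing (a e0) (r (alpha i)) * pairing (a (b i)) (r (alpha i)).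
have cC i : b i \in C -> c i = 1 \/ c i = -1.
  move=> biC; rewrite /c; have := covector_sqr (alpha i) (subsetP subDE _ e0D).
  rewrite bit_e0 biC => /sqr_int_le1[]->; case: (covector_dual1 dual_ba i) => ->; auto.
have cN i : b i \notin C -> c i = 0.
  move=> niC; rewrite /c; have := covector_sqr (alpha i) (subsetP subDE _ e0D).
  by rewrite bit_e0 (negPf niC) => /sqr_int_le1 ->; rewrite mul0r.
pose d e := \sum_(i | b i == e) c i.
have dE i : d (b i) = c i.
  rewrite /d (bigD1 i) //= big1 ?addr0 // => j /andP[/eqP/injb->].
  by rewrite eqxx.
exists (fun e => if e == e0 then 1 else - d e); split=> [e eD|].
  case: eqP => [_|/eqP ne]; first by left.
  have eC : e \in C by rewrite !inE ne.
  have [k ek] := (memB e).1 (subsetP subCB e eC).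
  by have := cC k; rewrite -ek eC ek dE => /(_ isT)[]->; rewrite ?opprK; auto.
rewrite (big_setD1 e0) //= eqxx scale1r {1}[a e0](covector_expand dual_ba) -/C.
rewrite (bigID (fun i => b i \in C)) /= [X in _ + X + _]big1 ?addr0 => [|i niC]; last first.
  by rewrite -/(c i) cN // scale0r.
rewrite -[X in _ + X]opprK -sumrN; apply/eqP; rewrite subr_eq0; apply/eqP.
rewrite [RHS](eq_bigr (fun e => d e *: a e)) => [|e]; last first.
  by rewrite !inE => /andP[/negPf-> _]; rewrite scaleNr opprK.
transitivity (\sum_(e in [set b i | i in [set i | b i \in C]]) d e *: a e).
  rewrite big_imset /=; last by move=> i j _ _; apply: injb.
  by apply: eq_big => i; rewrite ?inE // => _; rewrite dE.
apply: eq_bigl => e; apply/imsetP/idP => [[i iC ->]|eC]; first by rewrite inE in iC.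
have [k ek] := (memB e).1 (subsetP subCB e eC).
by exists k; rewrite // inE -ek.
Qed.

End Covectors.

(** * Cycles and cuts of a graph *)

Lemma uniq_map_inj (S T : eqType) (h : S -> T) (s : seq S) :
  uniq [seq h x | x <- s] -> {in s &, injective h}.
Proof.
elim: s => //= x s IHs /andP[xs /IHs inj_s] y y'; rewrite !inE.
move=> /predU1P[->|ys] /predU1P[->|y's] // eqh; last exact: inj_s.
  by case/mapP: xs; exists y'.
by case/mapP: xs; exists y.
Qed.

Section Cycles.
Variable G : graph.
Implicit Types (v w : vertex G) (f : edge G) (z : {ffun edge G -> 'F_2}).
Implicit Types (c : seq (dart G)) (X Y B D : {set edge G}).

Definition incidence v f : int := (head f == v)%:Z - (tail f == v)%:Z.

Lemma is_flowE (x : {ffun edge G -> int}) :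
  is_flow x <-> forall v, \sum_f incidence v f * x f = 0.
Proof.
have eq_v v : \sum_f incidence v f * x f =
    \sum_(f | head f == v) x f - \sum_(f | tail f == v) x f.
  rewrite [X in _ = X - _]big_mkcond [X in _ = _ - X]big_mkcond -sumrB.
  by apply: eq_bigr => f _; rewrite /incidence; do 2!case: (_ == v); lia.
by split=> flow v; have := flow v; rewrite eq_v.
Qed.

(** The binary cycle space, the kernel of the boundary map modulo 2. *)
Definition cycle2 z := forall v, \sum_f (incidence v f)%:~R * z f = 0.

Lemma cycle2D z z' : cycle2 z -> cycle2 z' -> cycle2 (z + z').
Proof.
move=> cz cz' v; under eq_bigr do rewrite ffunE mulrDr.
by rewrite big_split /= cz cz' addr0.
Qed.

Lemma cycle2_sum (I : finType) (P : pred I) (F : I -> {ffun edge G -> 'F_2}) :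
  (forall i, P i -> cycle2 (F i)) -> cycle2 (\sum_(i | P i) F i).
Proof.
move=> cF; apply: big_ind => //; last exact: cycle2D.
by move=> v; rewrite big1 // => f _; rewrite ffunE mulr0.
Qed.

Definition flow2 (x : {ffun edge G -> int}) : {ffun edge G -> 'F_2} :=
  [ffun f => (x f)%:~R].

Lemma flow2_cycle2 x : is_flow x -> cycle2 (flow2 x).
Proof.
move/is_flowE=> flow v; rewrite -[RHS](_ : (0%:~R : 'F_2) = 0) // -(flow v).
rewrite (big_morph _ (intrD _) (erefl _)).
by apply: eq_bigr => f _; rewrite ffunE intrM.
Qed.

Lemma sum_incidence (c : vertex G -> 'F_2) f :
  \sum_v c v * (incidence v f)%:~R = c (head f) + c (tail f).
Proof.
under eq_bigr do rewrite /incidence intrB mulrBr.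
rewrite sumrB -[X in _ = _ + X]F2_opp; congr (_ - _).
  rewrite (bigD1 (head f)) //= eqxx mulr1 big1 ?addr0 // => v /negPf.
  by rewrite eq_sym => ->; rewrite mulr0.
rewrite (bigD1 (tail f)) //= eqxx mulr1 big1 ?addr0 // => v /negPf.
by rewrite eq_sym => ->; rewrite mulr0.
Qed.

(** The cycle space is the common kernel of the boundaries at the vertices, so that a
    functional vanishing on it is a combination of these, which is a cut. *)
Lemma cycle2_orthogonal (omega : edge G -> 'F_2) :
  (forall z, cycle2 z -> \sum_f omega f * z f = 0) <->
  exists c : vertex G -> 'F_2, forall f, omega f = c (head f) + c (tail f).
Proof.
split=> [orth|[c omE] z cz]; last first.
  under eq_bigr do rewrite omE -sum_incidence mulr_suml.
  rewrite exchange_big big1 // => v _.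
  by under eq_bigr do rewrite -mulrA; rewrite -mulr_sumr cz mulr0.
pose F v z := \sum_f (incidence v f)%:~R * z f.
pose u z := \sum_f omega f * z f.
have [||||c cE] := @F2_functional_span _ _ F u (fun=> True).
- by [].
- move=> v z z'; rewrite /F -big_split; apply: eq_bigr => f _.
  by rewrite ffunE mulrDr.
- move=> z z'; rewrite /u -big_split; apply: eq_bigr => f _.
  by rewrite ffunE mulrDr.
- by move=> z _ cz; apply: orth.
exists c => f; pose z : {ffun edge G -> 'F_2} := [ffun f' => (f' == f)%:R].
have sumz (h : edge G -> 'F_2) : \sum_f' h f' * z f' = h f.
  rewrite (bigD1 f) //= ffunE eqxx mulr1 big1 ?addr0 // => f' /negPf.
  by rewrite ffunE => ->; rewrite mulr0.
have := cE z I; rewrite /u sumz => ->; rewrite -sum_incidence.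
by apply: eq_bigr => v _; rewrite /F sumz.
Qed.

(** ** Simple cycles *)

Definition dart_sign (d : dart G) : int := if d.2 then 1 else -1.

Definition cycle_flow c : {ffun edge G -> int} :=
  [ffun f => \sum_(d <- c | d.1 == f) dart_sign d].

Lemma cycle_flow_in c d : graph_cycle c -> d \in c -> cycle_flow c d.1 = dart_sign d.
Proof.
case=> _ uniq1 _ _ dc; rewrite ffunE big_mkcond (bigD1_seq d) //=; last exact: map_uniq uniq1.
rewrite eqxx big1_seq ?addr0 // => d' /andP[/eqP ne d'c].
by case: eqP => // dd'; case: ne; apply: (uniq_map_inj uniq1).
Qed.

Lemma cycle_flow_out c f : f \notin [seq d.1 | d <- c] -> cycle_flow c f = 0.
Proof.
move=> fc; rewrite ffunE big1_seq // => d /andP[/eqP df dc].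
by case/mapP: fc; exists d.
Qed.

Lemma path_tgt (d : dart G) p :
  path [rel d d' | dart_tgt d == dart_src d'] d p ->
  [seq dart_tgt d' | d' <- belast d p] = [seq dart_src d' | d' <- p].
Proof. by elim: p d => //= d' p IHp d /andP[/eqP-> /IHp->]. Qed.

Lemma cycle_tgt c : graph_cycle c ->
  perm_eq [seq dart_tgt d | d <- c] [seq dart_src d | d <- c].
Proof.
case: c => [|d p] [] // _ _ _ /= /path_tgt.
by rewrite belast_rcons /= => ->; rewrite map_rcons perm_rcons.
Qed.

Lemma cycle_flow_is_flow c : graph_cycle c -> is_flow (cycle_flow c).
Proof.
move=> cycle_c; apply/is_flowE => v.
have -> : \sum_f incidence v f * cycle_flow c f =
    \sum_(d <- c) ((dart_tgt d == v)%:Z - (dart_src d == v)%:Z).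
  under eq_bigr do rewrite ffunE mulr_sumr.
  rewrite (exchange_big_dep xpredT) //=; apply: eq_bigr => d _.
  rewrite (big_pred1 d.1) => [|f]; last by rewrite /= eq_sym.
  by rewrite /incidence /dart_sign /dart_tgt /dart_src; case: d.2; lia.
rewrite sumrB; apply/eqP; rewrite subr_eq0; apply/eqP.
rewrite -(big_map (@dart_tgt G) xpredT (fun w => (w == v)%:Z)).
by rewrite (perm_big _ (cycle_tgt cycle_c)) big_map.
Qed.

Lemma dart_sign_F2 (d : dart G) : (dart_sign d)%:~R = 1 :> 'F_2.
Proof. by rewrite /dart_sign; case: d.2; rewrite ?intrN ?F2_opp. Qed.

Lemma cycle_flow2 c f : graph_cycle c ->
  flow2 (cycle_flow c) f = (f \in [seq d.1 | d <- c])%:R.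
Proof.
move=> cycle_c; rewrite ffunE; have [/mapP[d dc ->]|fc] := boolP (f \in _).
  by rewrite cycle_flow_in // dart_sign_F2.
by rewrite cycle_flow_out.
Qed.

(** In the boundary at [v], the contribution of [f] has to be cancelled. *)
Lemma cycle2_next z v f : cycle2 z -> z f != 0 -> incidence v f != 0 ->
  exists f', [/\ f' != f, z f' != 0 & incidence v f' != 0].
Proof.
move=> cz zf vf; apply: contrapT => nof; have := cz v.
rewrite (bigD1 f) //= big1 => [|f' f'f].
  rewrite addr0 (F2_neq0 zf) mulr1 => /F2_int_half[m]; move: vf.
  by rewrite /incidence; do 2!case: (_ == v); lia.
have [->|zf'] := eqVneq (z f') 0; first by rewrite mulr0.
have [->|vf'] := eqVneq (incidence v f') 0; first by rewrite mul0r.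
by case: nof; exists f'.
Qed.

(** In the support of a binary cycle, a path of darts extends at its front: the
    source of its first dart, unless this is a loop, meets a second edge of the
    support.  Once the new source is a repeated vertex, a cycle is closed. *)
Lemma cycle2_has_cycle z : cycle2 z -> z != 0 ->
  exists2 c : seq (dart G), graph_cycle c & {in c, forall d, z d.1 != 0}.
Proof.
move=> cz z0; have [f0 zf0] : exists f, z f != 0.
  apply: contrapT => nof; case/eqP: z0; apply/ffunP => f; rewrite ffunE.
  by apply/eqP/negPn/negP => zf; apply: nof; exists f.
pose e := [rel d d' : dart G | dart_tgt d == dart_src d'].
suff main n d p : (#|vertex G| <= size p + n)%N -> path e d p ->
    uniq [seq dart_src d' | d' <- d :: p] -> uniq [seq d'.1 | d' <- d :: p] ->
    {in d :: p, forall d', z d'.1 != 0} ->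
    exists2 c : seq (dart G), graph_cycle c & {in c, forall d, z d.1 != 0}.
  apply: (main #|vertex G| (f0, true) [::]) => //= d.
  by rewrite inE => /eqP->.
elim: n d p => [|n IHn] d p size_p path_p uniq_src uniq_edge supp_p.
  move/card_uniqP: uniq_src => /= size_src.
  have := max_card [in [seq dart_src d' | d' <- d :: p]].
  by rewrite size_src size_map; lia.
have [loop|noloop] := eqVneq (dart_tgt d) (dart_src d).
  exists [:: d]; first by split=> //=; rewrite loop eqxx.
  by move=> d'; rewrite inE => /eqP->; apply: supp_p; rewrite mem_head.
have inc_d : incidence (dart_src d) d.1 != 0.
  move: noloop; rewrite /incidence /dart_src /dart_tgt eq_sym.
  by case: d.2; rewrite eqxx => /negPf; rewrite 1?eq_sym => ->.
have [f' [f'd zf' inc_f']] := cycle2_next cz (supp_p d (mem_head _ _)) inc_d.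
have [b tgt_b] : exists b, dart_tgt (f', b) = dart_src d.
  have [hf|nhf] := eqVneq (head f') (dart_src d); first by exists true.
  exists false; rewrite /dart_tgt /=; apply/eqP; move: inc_f'.
  by rewrite /incidence (negPf nhf); case: (tail f' == _).
pose d' : dart G := (f', b).
set s := d :: p in uniq_src uniq_edge supp_p *.
have path_s : path e d' s by rewrite /= tgt_b eqxx.
have new_edge q : {subset q <= s} ->
    dart_src d' \notin [seq dart_src d2 | d2 <- q] -> f' \notin [seq d2.1 | d2 <- q].
  move=> sub_q src_q; apply/negP => /mapP[[f2 b2] d2q /= f2E].
  have [bb|bb] := eqVneq b2 b.
    by case/negP: src_q; apply/mapP; exists (f2, b2); rewrite // /d' f2E bb.
  have /(uniq_map_inj uniq_src) : dart_src (f2, b2) = dart_src d.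
    rewrite -tgt_b /d' f2E /dart_src /dart_tgt /=.
    by case: b bb {d' path_s src_q tgt_b}; case: b2 {d2q}.
  move=> /(_ (sub_q _ d2q) (mem_head _ _)) d2d.
  by case/eqP: f'd; rewrite f2E -d2d.
have [closed|fresh] := boolP (dart_src d' \in [seq dart_src d2 | d2 <- s]).
  pose k := index (dart_src d') [seq dart_src d2 | d2 <- s].
  have lt_k : (k < size s)%N by rewrite -(size_map (@dart_src G)) index_mem.
  have sub_s : {subset take k s <= s} by move=> d2 /mem_take.
  have src_k : dart_src d' \notin [seq dart_src d2 | d2 <- take k s].
    by rewrite map_take in_take // ltnn.
  exists (d' :: take k s); last first.
    by move=> d2; rewrite inE => /predU1P[->|/sub_s/supp_p].
  split=> //.
  - by rewrite map_cons cons_uniq new_edge // map_take take_uniq.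
  - by rewrite map_cons cons_uniq src_k map_take take_uniq.
  move: path_s; rewrite -{1}(cat_take_drop k s) cat_path (drop_nth d lt_k).
  rewrite /= rcons_path => /andP[-> /andP[/= /eqP-> _]].
  by rewrite -(nth_map d (dart_src d)) // nth_index.
apply: (IHn d' s) => //.
- by rewrite /= addSnnS.
- by rewrite map_cons cons_uniq fresh.
- by rewrite map_cons cons_uniq uniq_edge new_edge.
by move=> d2; rewrite inE => /predU1P[->|/supp_p].
Qed.

(** Peeling off simple cycles orients the support of a binary cycle. *)
Lemma cycle2_signed_flow z : cycle2 z ->
  exists x : {ffun edge G -> int},
    [/\ is_flow x, flow2 x = z & forall f, x f = 0 \/ x f ^+ 2 = 1].
Proof.
have [m] := ubnP #|[set f | z f != 0]|; elim: m z => // m IHm z /ltnSE-le_m cz.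
have [->|z0] := eqVneq z 0.
  exists 0; split=> [v||f].
  - by rewrite !big1 ?subr0 // => f _; rewrite ffunE.
  - by apply/ffunP=> f; rewrite !ffunE.
  by left; rewrite ffunE.
have [c cycle_c supp_c] := cycle2_has_cycle cz z0.
have [d0 d0c] : exists d, d \in c.
  by case: c cycle_c {supp_c} => [[]//|d c _]; exists d; rewrite mem_head.
pose y := cycle_flow c; pose z' := z + flow2 y.
have cy : cycle2 (flow2 y) by apply/flow2_cycle2/cycle_flow_is_flow.
have z'E f : z' f = if f \in [seq d.1 | d <- c] then 0 else z f.
  rewrite ffunE /y cycle_flow2 //; case: ifP => [/mapP[d dc ->]|_]; last by rewrite addr0.
  by rewrite (F2_neq0 (supp_c d dc)) F2_addxx.
have lt_m : (#|[set f | z' f != 0%R]| < m)%N.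
  apply: leq_trans le_m; apply: proper_card; apply/properP; split.
    by apply/subsetP=> f; rewrite !inE z'E; case: ifP; rewrite ?eqxx.
  by exists d0.1; rewrite !inE ?z'E ?map_f ?eqxx ?supp_c.
have [x [flow_x x2 x1]] := IHm z' lt_m (cycle2D cz cy).
have y1 f : y f = 0 \/ y f ^+ 2 = 1.
  have [/mapP[d dc ->]|fc] := boolP (f \in [seq d.1 | d <- c]).
    by right; rewrite /y cycle_flow_in // /dart_sign; case: d.2.
  by left; rewrite /y cycle_flow_out.
have x0 f : y f != 0 -> x f = 0.
  move=> yf; have fc : f \in [seq d.1 | d <- c].
    by apply: contraNT yf => fc; rewrite /y cycle_flow_out.
  move/ffunP/(_ f): x2; rewrite z'E fc ffunE; case: (x1 f) => // xf.
  by move/F2_int_half=> [n xn]; move: xf; rewrite xn; nia.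
have flow2D : flow2 (x + y) = flow2 x + flow2 y.
  by apply/ffunP=> f; rewrite !ffunE intrD.
exists (x + y); split.
- move/is_flowE: flow_x => flow_x; have /is_flowE flow_y := cycle_flow_is_flow cycle_c.
  apply/is_flowE => v; under eq_bigr do rewrite ffunE mulrDr.
  by rewrite big_split /= flow_x flow_y.
- rewrite flow2D x2; apply/ffunP=> f.
  by rewrite [in LHS]ffunE ffunE -addrA F2_addxx addr0.
move=> f; rewrite ffunE; have [->|yf] := eqVneq (y f) 0; first by rewrite addr0.
by rewrite x0 // add0r; case: (y1 f) => [y0|]; [rewrite y0 eqxx in yf | right].
Qed.

(** ** The graphic matroid and its dual *)

Lemma graphic_indepP X :
  indep (graphic_matroid G) X <->
  forall z, cycle2 z -> (forall f, z f != 0 -> f \in X) -> z = 0.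
Proof.
split=> [indX z cz subX|indX c cycle_c subX].
  apply/eqP/negPn/negP => z0; have [c cycle_c supp_c] := cycle2_has_cycle cz z0.
  by apply: (indX c cycle_c) => f /mapP[d dc ->]; apply/subX/supp_c.
have cy : cycle2 (flow2 (cycle_flow c)) by apply/flow2_cycle2/cycle_flow_is_flow.
have y0 : flow2 (cycle_flow c) = 0.
  apply: indX => // f; rewrite cycle_flow2 //.
  case: (boolP (f \in [seq d.1 | d <- c])) => [fc _|_].
    exact: subX.
  by rewrite eqxx.
case: c cycle_c {subX cy} y0 => [|d c] cycle_c y0; first by case: cycle_c.
by move/ffunP/(_ d.1): y0; rewrite cycle_flow2 // ffunE mem_head.
Qed.

(** Adding an edge to a maximal forest closes its fundamental cycle. *)
Lemma fundamental_cycle B Y f : indep (graphic_matroid G) B -> B \subset Y ->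
  (forall X, X \subset Y -> indep (graphic_matroid G) X -> B \subset X -> X = B) ->
  f \in Y -> f \notin B ->
  exists z, [/\ cycle2 z, z f = 1 & forall f', z f' != 0 -> f' \in f |: B].
Proof.
move=> indB subBY maxB fY fB.
have dep : ~ indep (graphic_matroid G) (f |: B).
  move=> ind; have := setU11 f B; rewrite (maxB (f |: B)) ?(negPf fB) ?subsetUr //.
  by rewrite subUset sub1set fY.
move: dep => /graphic_indepP/existsNP[z] /not_implyP[cz] /not_implyP[supp_z z0].
exists z; split=> //; apply/F2_neq0/eqP => zf; apply: z0.
apply: ((graphic_indepP B).1 indB) => // f' zf'.
by have := supp_z f' zf'; rewrite !inE => /predU1P[f'f|//]; rewrite f'f zf eqxx in zf'.
Qed.

(** The coordinates at the edges of [X] are independent functionals on the cycle space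
    when a maximal forest avoids [X], thanks to the fundamental cycles of these edges.
    Conversely, if they are independent, a forest [B] that is maximal outside [X] is
    maximal: for [f] in [X] some binary cycle meets [X] in [f] only, and fundamental
    cycles of the edges outside [X] bring it into [B] and [f]. *)
Lemma dual_graphic_indepP X :
  indep (dual_matroid (graphic_matroid G)) X <->
  forall D, D \subset X -> (forall z, cycle2 z -> \sum_(f in D) z f = 0) -> D = set0.
Proof.
split=> [[_ [B [[indB maxB] disXB]]] D subDX orthD|indX].
  apply/setP=> f; rewrite in_set0; apply/negP => fD.
  have notB f' : f' \in D -> f' \notin B.
    by move/(subsetP subDX) => f'X; apply: contraTN f'X => f'B; rewrite (disjointFl disXB).
  have [|z [cz zf supp_z]] :=
    @fundamental_cycle B setT f indB (subsetT _) _ (in_setT _) (notB f fD).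
    by move=> Y _; apply: maxB.
  have := orthD z cz; rewrite (bigD1 f) //= zf big1 => [/eqP|f' /andP[f'D f'f]].
    by rewrite addr0 oner_eq0.
  apply/eqP/negPn/negP => /supp_z; rewrite !inE (negPf f'f) /=.
  by rewrite (negPf (notB _ f'D)).
split; first exact: subsetT.
pose P (Y : {set edge G}) := (Y \subset ~: X) && `[< indep (graphic_matroid G) Y >].
have P0 : P set0.
  rewrite /P sub0set; apply/asboolP/graphic_indepP => z _ supp0; apply/ffunP=> f.
  by rewrite ffunE; apply/eqP/negPn/negP => /supp0; rewrite inE.
have [B /maxsetP[/andP[subBX /asboolP indB] maxB] _] := maxset_exists P0.
exists B; split; last by rewrite disjoint_sym disjoints_subset.
split=> // Y indY subBY; apply/eqP; rewrite eqEsubset subBY andbT; apply/subsetP => f fY.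
apply/negPn/negP => fB.
have fX : f \in X.
  apply/negPn/negP => fX; have : f \in f |: B by rewrite setU11.
  rewrite (maxB (f |: B)) ?(negPf fB) ?subsetUr // /P subUset sub1set inE fX subBX.
  apply/asboolP/graphic_indepP => z cz supp_z; apply: ((graphic_indepP Y).1 indY) => // f'.
  by move/supp_z; rewrite !inE => /predU1P[->//|/(subsetP subBY)].
(* a binary cycle meeting X in the single edge f *)
have [z [cz zf zX]] : exists z, [/\ cycle2 z, z f = 1
    & forall f', f' \in X -> f' != f -> z f' = 0].
  apply: contrapT => noz; pose F f' z := if (f' \in X) && (f' != f) then z f' else 0.
  have [||||c cE] := @F2_functional_span _ _ F (fun z => z f) cycle2.
  - exact: cycle2D.
  - by move=> f' z z'; rewrite /F; case: ifP; rewrite ?ffunE ?addr0.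
  - by move=> z z'; rewrite ffunE.
  - move=> z cz zX; apply/eqP/negPn/negP => /F2_neq0 zf; apply: noz; exists z; split=> //.
    by move=> f' f'X f'f; have := zX f'; rewrite /F f'X f'f.
  pose D := f |: [set f' in X | (f' != f) && (c f' != 0)].
  have : f \in D by rewrite setU11.
  rewrite (indX D) ?inE //.
    by rewrite subUset sub1set fX; apply/subsetP=> f'; rewrite inE => /andP[].
  move=> z cz; rewrite big_setU1 /=; last by rewrite !inE eqxx andbF.
  rewrite (cE z cz); set S := \sum_(f' in _) _; set S' := \sum_f' _.
  suff -> : S' = S by rewrite F2_addxx.
  rewrite /S /S' [RHS]big_mkcond; apply: eq_bigr => f' _; rewrite inE /F.
  case: (f' \in X); case: (f' != f); rewrite ?mulr0 //=.
  by have [->|/F2_neq0->] := eqVneq (c f') 0; rewrite ?mul0r ?mul1r.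
have fund f' : exists z', f' \notin X -> f' \notin B ->
    [/\ cycle2 z', z' f' = 1 & forall f'', z' f'' != 0 -> f'' \in f' |: B].
  have [f'X|f'X] := boolP (f' \in X); first by exists 0.
  have [f'B|f'B] := boolP (f' \in B); first by exists 0.
  have [|||z' z'P] := @fundamental_cycle B (~: X) f' indB subBX; rewrite ?inE //.
    by move=> Y' subY' indY' subB; apply: maxB; rewrite // /P subY'; apply/asboolP.
  by exists z'.
have [zf' zf'P] := choice fund.
pose outer := [set f' | [&& f' \notin X, f' \notin B & z f' != 0]].
pose w := z + \sum_(f' in outer) zf' f'.
have outerP f' : f' \in outer -> [/\ cycle2 (zf' f'), zf' f' f' = 1 &
    forall f'', zf' f' f'' != 0 -> f'' \in f' |: B].
  by rewrite inE => /and3P[f'X f'B _]; apply: zf'P.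
have cw : cycle2 w.
  by apply: cycle2D => //; apply: cycle2_sum => f' /outerP[].
have wE f'' : f'' \notin B -> w f'' = if f'' \in X then z f'' else 0.
  move=> f''B; rewrite ffunE sum_ffunE.
  have zero f' : f' \in outer -> f'' != f' -> zf' f' f'' = 0.
    move=> /outerP[_ _ supp] ne; apply/eqP/negPn/negP => /supp.
    by rewrite !inE (negPf f''B) (negPf ne).
  have [f''o|f''o] := boolP (f'' \in outer).
    rewrite (bigD1 f'') //= big1 => [|f' /andP[f'o ne]]; last by rewrite zero // eq_sym.
    have [_ -> _] := outerP _ f''o; move: f''o; rewrite inE => /and3P[/negPf-> _ /F2_neq0->].
    by rewrite addr0 F2_addxx.
  rewrite big1 ?addr0 => [|f' f'o]; last by apply: zero => //; apply: contraNneq f''o => ->.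
  move: f''o; rewrite inE f''B /= negb_and !negbK; case: (f'' \in X) => //=.
  by move/eqP.
have : w = 0.
  apply: ((graphic_indepP Y).1 indY) => // f'' wf''.
  have [/(subsetP subBY)//|f''B] := boolP (f'' \in B).
  move: wf''; rewrite wE //; case: ifP => [f''X zf''|_]; last by rewrite eqxx.
  by have [->//|ne] := eqVneq f'' f; rewrite zX // eqxx in zf''.
by move/ffunP/(_ f); rewrite wE // fX zf ffunE.
Qed.

End Cycles.

(** * Binary representations of cographic matroids *)

(** A relation of the first kind is a disjoint union of minimal ones, and these are
    relations of the second kind because the dependent sets are the same. *)
Lemma relations_sub (T : finType) (R1 R2 : {set T} -> Prop) :
  R2 set0 ->
  (forall C D : {set T}, C \subset D -> R2 C -> R2 (D :\: C) -> R2 D) ->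
  (forall C D : {set T}, C \subset D -> R1 C -> R1 D -> R1 (D :\: C)) ->
  (forall X : {set T}, (forall D : {set T}, D \subset X -> R1 D -> D = set0) <->
                       (forall D : {set T}, D \subset X -> R2 D -> D = set0)) ->
  forall D, R1 D -> R2 D.
Proof.
move=> R20 R2U R1D same D.
have [m] := ubnP #|D|; elim: m D => // m IHm D /ltnSE-le_m R1D0.
have [->//|D0] := eqVneq D set0.
have dep1 X : ~ (forall D : {set T}, D \subset X -> R1 D -> D = set0) ->
    exists2 C : {set T}, C \subset X & R1 C /\ C != set0.
  move=> dep; apply: contrapT => noC; apply: dep => C CX RC.
  by apply/eqP/negPn/negP => C0; apply: noC; exists C.
have dep2 X : ~ (forall D : {set T}, D \subset X -> R2 D -> D = set0) ->
    exists2 C : {set T}, C \subset X & R2 C /\ C != set0.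
  move=> dep; apply: contrapT => noC; apply: dep => C CX RC.
  by apply/eqP/negPn/negP => C0; apply: noC; exists C.
pose P C := `[< R1 C /\ C != set0 >].
have [C /minsetP[/asboolP[R1C C0] minC] CD] :=
  @minset_exists _ P D (introT (asboolP _) (conj R1D0 D0)).
have [C2 C2C [R2C2 C20]] : exists2 C2 : {set T}, C2 \subset C & R2 C2 /\ C2 != set0.
  by apply: dep2 => /same/(_ C (subxx _) R1C)/eqP; apply/negP.
have [C1 C1C2 [R1C1 C10]] : exists2 C1 : {set T}, C1 \subset C2 & R1 C1 /\ C1 != set0.
  by apply: dep1 => /same/(_ C2 (subxx _) R2C2)/eqP; apply/negP.
have C1C : C1 = C by apply: minC; [apply/asboolP | apply: subset_trans C2C].
have C2E : C2 = C by apply/eqP; rewrite eqEsubset C2C -{1}C1C.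
apply: (R2U C) => //; first by rewrite -C2E.
apply: IHm; last exact: R1D.
apply: leq_trans le_m; rewrite cardsD (setIidPr CD) ltn_subrL !card_gt0 C0.
exact: D0.
Qed.

Section Representation.
Variables (g : nat) (E : {set 'cV['F_2]_g}).

Lemma binary_indep_imset (T : finType) (phi : T -> 'cV['F_2]_g) (X : {set T}) :
  injective phi -> phi @: X \subset E ->
  indep (binary_matroid E) (phi @: X) <->
  forall D : {set T}, D \subset X -> \sum_(f in D) phi f = 0 -> D = set0.
Proof.
move=> inj_phi subE; split=> [[_ /F2_free_setP indX] D DX sumD|indX].
  have : phi @: D = set0.
    by apply: indX; rewrite ?imsetS // big_imset //= => f f' _ _; apply: inj_phi.
  by move/eqP; rewrite -!cards_eq0 card_imset // => /eqP/cards0_eq.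
split=> //; apply/F2_free_setP => D DX sumD.
have DE : D = phi @: (phi @^-1: D).
  apply/setP=> e; apply/idP/imsetP => [eD|[f]]; last by rewrite inE => fD ->.
  by have /imsetP[f fX ef] := subsetP DX e eD; exists f; rewrite // inE -ef.
rewrite DE (indX (phi @^-1: D)) ?imset0 //.
  apply/subsetP=> f; rewrite inE => /(subsetP DX)/imsetP[f' f'X /inj_phi->] //.
by rewrite -[RHS]sumD [in RHS]DE big_imset //= => f f' _ _; apply: inj_phi.
Qed.

(** Both matroids have a binary representation, the dual graphic one by the coordinates
    of binary cycles, and [relations_sub] recovers the linear relations from the
    dependent sets. *)
Lemma matroid_isoP (G : graph) (phi : edge G -> 'cV['F_2]_g) :
  matroid_iso (dual_matroid (graphic_matroid G)) (binary_matroid E) phi <->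
  [/\ injective phi, phi @: setT = E &
    forall D : {set edge G}, \sum_(f in D) phi f = 0 <->
      forall z, cycle2 z -> \sum_(f in D) z f = 0].
Proof.
pose R1 (D : {set edge G}) := \sum_(f in D) phi f = 0.
pose R2 (D : {set edge G}) := forall z, cycle2 z -> \sum_(f in D) z f = 0.
have sumID (V : zmodType) (F : edge G -> V) (C D : {set edge G}) : C \subset D ->
    \sum_(f in D) F f = \sum_(f in C) F f + \sum_(f in D :\: C) F f.
  by move=> CD; rewrite (big_setID C) /= (setIidPr CD).
have R1U (C D : {set edge G}) : C \subset D -> R1 C -> R1 (D :\: C) -> R1 D.
  by move=> CD; rewrite /R1 (sumID _ _ _ _ CD) => -> ->; rewrite addr0.
have R1D (C D : {set edge G}) : C \subset D -> R1 C -> R1 D -> R1 (D :\: C).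
  by move=> CD; rewrite /R1 (sumID _ _ _ _ CD) => -> ; rewrite add0r.
have R2U (C D : {set edge G}) : C \subset D -> R2 C -> R2 (D :\: C) -> R2 D.
  by move=> CD R2C R2D z cz; rewrite (sumID _ _ _ _ CD) R2C // R2D // addr0.
have R2D (C D : {set edge G}) : C \subset D -> R2 C -> R2 D -> R2 (D :\: C).
  by move=> CD R2C R2D z cz; have := R2D z cz; rewrite (sumID _ _ _ _ CD) R2C // add0r.
have R10 : R1 set0 by rewrite /R1 big_set0.
have R20 : R2 set0 by move=> z _; rewrite big_set0.
split=> [[inj_phi im_phi iso]|[inj_phi im_phi rel]].
  have {}im_phi : phi @: setT = E := im_phi.
  have {}inj_phi : injective phi by move=> f f'; apply: inj_phi; rewrite inE.
  have same (X : {set edge G}) :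
      (forall D : {set edge G}, D \subset X -> R1 D -> D = set0) <->
      (forall D : {set edge G}, D \subset X -> R2 D -> D = set0).
    rewrite -(dual_graphic_indepP X) iso ?subsetT // binary_indep_imset //.
    by rewrite -im_phi imsetS ?subsetT.
  split=> // D; split; first by apply: (relations_sub R20 R2U R1D same).
  by apply: (relations_sub R10 R1U R2D) => X; apply: iff_sym.
split=> [f f' _ _ /inj_phi//|//|X _].
rewrite dual_graphic_indepP binary_indep_imset //; last by rewrite -im_phi imsetS ?subsetT.
by split=> indX D DX relD; apply: indX => //; apply/rel.
Qed.

End Representation.

(** ** Identifying vertices *)

Section Quotient.
Variables (G : graph) (V : finType) (p : vertex G -> V).

Definition quotient_graph : graph :=
  @Graph V (edge G) (fun f => p (tail f)) (fun f => p (head f)).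

Lemma quotient_boundary (z : edge G -> 'F_2) (w : V) :
  \sum_(f : edge G) (@incidence quotient_graph w f)%:~R * z f =
  \sum_(v | p v == w) \sum_f (incidence v f)%:~R * z f.
Proof.
rewrite exchange_big; apply: eq_bigr => f _ /=; rewrite -mulr_suml; congr (_ * _).
have ind v : ((p v == w)%:Z)%:~R = \sum_(v' | p v' == w) ((v == v')%:Z)%:~R :> 'F_2.
  have [pv|pv] := boolP (p v == w).
    rewrite (bigD1 v) //= eqxx big1 ?addr0 // => v' /andP[_ /negPf].
    by rewrite eq_sym => ->.
  rewrite big1 // => v' pv'; case: eqP => // vv'.
  by rewrite vv' pv' in pv.
rewrite /incidence intrB /= !ind -sumrB; apply: eq_bigr => v _.
by rewrite intrB.
Qed.

End Quotient.

Section Components.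
Variables (T : finType) (e : rel T).
Hypothesis sym_e : symmetric e.

Let connect_e : connect_sym e.
Proof. exact: sym_connect_sym. Qed.

Lemma root_adjacent u v : e u v -> fingraph.root e u = fingraph.root e v.
Proof. by move=> euv; apply/(fingraph.rootP connect_e)/connect1. Qed.

Lemma root_idem v : fingraph.root e (fingraph.root e v) = fingraph.root e v.
Proof. exact: fingraph.root_root. Qed.

Lemma connect_root_eq v : connect e (fingraph.root e v) v.
Proof. by rewrite connect_e connect_root. Qed.

End Components.

Lemma homo_connect (S T : finType) (e : rel S) (e' : rel T) (h : S -> T) :
  (forall u v, e u v -> e' (h u) (h v)) ->
  forall u v, connect e u v -> connect e' (h u) (h v).
Proof.
move=> he u v /connectP[q]; elim: q u => [|w q IHq] u /= => [_ ->|/andP[euw path_q] lastv].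
  exact: connect0.
by apply: connect_trans (connect1 (he _ _ euw)) (IHq _ path_q lastv).
Qed.

Lemma adjacent_sym (G : graph) : symmetric (@adjacent G).
Proof.
by move=> u v /=; apply/existsP/existsP => -[f fuv]; exists f; rewrite orbC.
Qed.

Lemma adjacent_edge (G : graph) (f : edge G) : adjacent (tail f) (head f).
Proof. by apply/existsP; exists f; rewrite !eqxx. Qed.

(** Identifying one vertex of each component gives a connected graph with the
    same cycle space: within a component, the boundary at the chosen vertex is
    determined by the other ones. *)
Lemma connected_same_cycles (G : graph) :
  exists (V : finType) (p : vertex G -> V), connected_graph (quotient_graph p) /\
    forall z : {ffun edge G -> 'F_2},
      cycle2 z <-> @cycle2 (quotient_graph p) z.
Proof.
pose e := @adjacent G; have sym_e : symmetric e := @adjacent_sym G.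
pose p (v : vertex G) : option {v | fingraph.root e v != v} := insub v.
have p_root v : p (fingraph.root e v) = None.
  by rewrite /p insubN // root_idem // eqxx.
have p_inj u v : fingraph.root e v != v -> (p u == p v) = (u == v).
  move=> rv; rewrite /p (insubT (fun v => fingraph.root e v != v) rv).
  have [->|uv] := eqVneq u v; first by rewrite insubT /= eqxx.
  case: insubP => [u' _ u'E|//]; apply/eqP => -[/(congr1 val)].
  by rewrite u'E => /eqP; rewrite (negPf uv).
exists _, p; split; last first.
  move=> z; split=> cz.
    by move=> w; rewrite [LHS](quotient_boundary p z w) big1 // => v _; apply: cz.
  have nonroot v : fingraph.root e v != v -> \sum_f (incidence v f)%:~R * z f = 0.
    move=> rv; have := etrans (esym (quotient_boundary p z (p v))) (cz (p v)).
    by rewrite (eq_bigl _ _ (fun u => p_inj u v rv)) big_pred1_eq.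
  move=> v; have [/nonroot//|/negPn/eqP rv] := boolP (fingraph.root e v != v).
  have : \sum_(u | fingraph.root e u == v) \sum_f (incidence u f)%:~R * z f = 0.
    rewrite -(@quotient_boundary G _ (fingraph.root e)) big1 // => f _.
    rewrite /incidence /= (root_adjacent sym_e (adjacent_edge f)) subrr.
    by rewrite mul0r.
  rewrite (bigD1 v) ?rv //= [X in _ + X]big1 ?addr0 // => u /andP[/eqP ru uv].
  by apply: nonroot; rewrite ru eq_sym.
have to_None w : connect (@adjacent (quotient_graph p)) None w.
  case: w => [[v rv]|]; last exact: connect0.
  have -> : Some (exist _ v rv) = p v.
    by rewrite /p insubT.
  rewrite -(p_root v); apply: (homo_connect (e := e)); last exact: connect_root_eq.
  by move=> u w /existsP[f fuw]; apply/existsP; exists f; move: fuw => /=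
    /orP[/andP[/eqP-> /eqP->]|/andP[/eqP-> /eqP->]]; rewrite !eqxx ?orbT.
split; first by apply/card_gt0P; exists None.
move=> u w; apply: connect_trans (to_None w).
by rewrite (sym_connect_sym (@adjacent_sym _)).
Qed.

Lemma cographic_connected g (E : {set 'cV['F_2]_g}) : cographic (binary_matroid E) ->
  exists Gphi : {G : graph & edge G -> 'cV['F_2]_g},
    connected_graph (tag Gphi) /\
    matroid_iso (dual_matroid (graphic_matroid (tag Gphi))) (binary_matroid E) (tagged Gphi).
Proof.
move=> [G [phi /matroid_isoP[inj_phi im_phi rel]]].
have [V [p [conn same]]] := connected_same_cycles G.
exists (existT _ (quotient_graph p) phi); split; first exact: conn.
apply/(@matroid_isoP _ E (quotient_graph p) phi).
split=> // D; rewrite rel.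
by split=> orth z /same cz; apply: orth.
Qed.

(** ** Graphs whose cycles are given by labels *)

Section Labelled.
Variables (g : nat) (G : graph) (label : edge G -> 'cV['F_2]_g).
Hypothesis labelP : forall z : {ffun edge G -> 'F_2},
  cycle2 z <-> exists alpha, forall f, z f = pairing (label f) alpha.

(** Contract the edges that are not chosen as the representative of a label.  The
    cuts of the contracted graph are those cuts of [G] that consist of chosen
    edges, so they express the relations between the chosen labels. *)
Lemma labelled_cographic (E : {set 'cV['F_2]_g}) :
  (forall e, e \in E -> exists f, label f = e) -> cographic (binary_matroid E).
Proof.
move=> labelE.
have [F FE] := choice (fun e : {e | e \in E} => labelE _ (valP e)).
have injF : injective F.
  by move=> e e' /(congr1 label); rewrite !FE => /val_inj.
pose chosen f := [exists e, F e == f].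
pose e := [rel u v | [exists f : edge G, ~~ chosen f &&
  (((tail f == u) && (head f == v)) || ((tail f == v) && (head f == u)))]].
have sym_e : symmetric e.
  by move=> u v /=; apply/existsP/existsP => -[f fuv]; exists f; rewrite orbC.
pose p := fingraph.root e.
have p_same f : ~~ chosen f -> p (tail f) = p (head f).
  by move=> nf; apply: (root_adjacent sym_e); apply/existsP; exists f; rewrite nf !eqxx.
pose G' := @Graph (vertex G) {e | e \in E} (fun e => p (tail (F e))) (fun e => p (head (F e))).
exists G', (fun e : edge G' => val e); apply/matroid_isoP.
split; first exact: val_inj.
  apply/setP=> l; apply/imsetP/idP => [[l' _ ->]|lE]; first exact: valP.
  by exists (exist _ l lE).
move=> D.
have sumD (V : zmodType) (h : edge G -> V) :
    \sum_(l in D) h (F l) = \sum_(f in F @: D) h f.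
  by rewrite big_imset //= => l l' _ _; apply: injF.
have sum_indic (I : finType) (A : {set I}) (h : I -> 'F_2) :
    \sum_i (i \in A)%:R * h i = \sum_(i in A) h i.
  rewrite [RHS]big_mkcond; apply: eq_bigr => i _.
  by case: (i \in A); rewrite ?mul1r ?mul0r.
have unchosen f : ~~ chosen f -> f \notin F @: D.
  by move=> nf; apply: contra nf => /imsetP[l _ ->]; apply/existsP; exists l.
have sum_label : \sum_(l in D) (val l : 'cV['F_2]_g) = \sum_(f in F @: D) label f.
  by rewrite -sumD; apply: eq_bigr => l _; rewrite FE.
rewrite sum_label; split=> [sum0 z' cz'|orth].
  have [c cE] : exists c : vertex G -> 'F_2, forall f,
      (f \in F @: D)%:R = c (head f) + c (tail f).
    apply/cycle2_orthogonal => z /labelP[alpha zE]; rewrite sum_indic.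
    by under eq_bigr do rewrite zE; rewrite -pairing_suml sum0 pairing0l.
  have c_root v : c (p v) = c v.
    have /connectP[q path_q pE] := connect_root e v; rewrite /p pE {pE}.
    elim: q v path_q => //= w q IHq v /andP[evw /IHq ->].
    case/existsP: evw => f /andP[nf vw]; have := cE f.
    rewrite (negPf (unchosen f nf)) => /esym/eqP.
    rewrite addr_eq0 F2_opp => /eqP ch.
    by case/orP: vw => /andP[/eqP<- /eqP<-]; rewrite ch.
  rewrite -sum_indic.
  apply: ((@cycle2_orthogonal G' (fun l => (l \in D)%:R)).2 _ z' cz').
  exists c => l; rewrite /= !c_root -cE; congr (_%:R); congr nat_of_bool.
  by rewrite mem_imset.
have [c cE] : exists c : vertex G' -> 'F_2, forall l : edge G',
    (l \in D)%:R = c (head l) + c (tail l).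
  by apply/cycle2_orthogonal => z /orth; rewrite sum_indic.
apply: pairing_inj => alpha; rewrite pairing0l pairing_suml.
pose z := [ffun f => pairing (label f) alpha].
have cz : cycle2 z by apply/labelP; exists alpha => f; rewrite ffunE.
rewrite (eq_bigr z) => [|f _]; last by rewrite ffunE.
rewrite -sum_indic.
apply: ((@cycle2_orthogonal G (fun f => (f \in F @: D)%:R)).2 _ z cz).
exists (fun v => c (p v)) => f; have [/existsP[l /eqP<-]|nf] := boolP (chosen f).
  by rewrite mem_imset // cE.
by rewrite (negPf (unchosen f nf)) p_same // F2_addxx.
Qed.

(** For a connected graph, only constant functions have a zero coboundary, so the
    incidence matrix has rank one less than the number of vertices. *)
Lemma labelled_genus : connected_graph G ->
  (forall alpha, (forall f, pairing (label f) alpha = 0) -> alpha = 0) ->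
  genus G = g%:Z.
Proof.
move=> [V0 connG] label_inj.
pose n := #|edge G|; pose m := #|vertex G|.
pose M : 'M['F_2]_(n, m) := \matrix_(i, j) (incidence (enum_val j) (enum_val i))%:~R.
pose A : 'M['F_2]_(g, n) := \matrix_(i, j) label (enum_val j) i 0.
have kerM (u : 'rV['F_2]_n) : u *m M = 0 <-> cycle2 [ffun f => u 0 (enum_rank f)].
  split=> [uM v|cz].
    move/matrixP/(_ 0 (enum_rank v)): uM; rewrite !mxE => uM; rewrite -[RHS]uM.
    rewrite (reindex_onto enum_val enum_rank) => [|f _]; last exact: enum_rankK.
    under eq_bigl do rewrite enum_valK eqxx.
    by apply: eq_bigr => i _; rewrite ffunE enum_valK !mxE enum_rankK mulrC.
  apply/matrixP=> i j; rewrite ord1 !mxE -[RHS](cz (enum_val j)).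
  rewrite [RHS](reindex_onto enum_val enum_rank) => [|f _]; last exact: enum_rankK.
  under [RHS]eq_bigl do rewrite enum_valK eqxx.
  by apply: eq_bigr => k _; rewrite ffunE enum_valK !mxE mulrC.
have rowA (w : 'rV['F_2]_g) f : (w *m A) 0 (enum_rank f) = pairing (label f) w^T.
  rewrite pairingE mxE; apply: eq_bigr => i _.
  by rewrite !mxE enum_rankK mulrC.
have AM : A *m M = 0.
  apply/row_matrixP => i; rewrite row_mul row0; apply/kerM/labelP.
  exists (delta_mx i 0) => f; rewrite ffunE rowE rowA; congr pairing.
  by rewrite trmx_delta.
have freeA : row_free A.
  rewrite -kermx_eq0; apply/eqP/row_matrixP => k; rewrite row0.
  have : row k (kermx A) *m A = 0 by rewrite -row_mul mulmx_ker row0.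
  move: (row k _) => w wA; apply: trmx_inj; rewrite trmx0; apply: label_inj => f.
  by rewrite -rowA wA mxE.
have rank_ker : \rank (kermx M) = g.
  have := freeA; rewrite /row_free => /eqP rA; rewrite -[RHS]rA; apply/eqP.
  rewrite eqn_leq (mxrankS (_ : A <= kermx M)%MS) ?andbT; last exact/sub_kermxP.
  apply: mxrankS; apply/row_subP => k.
  have : row k (kermx M) *m M = 0 by rewrite -row_mul mulmx_ker row0.
  move: (row k _) => u /kerM/labelP[alpha uE]; apply/submxP; exists alpha^T.
  apply/matrixP=> i j; rewrite ord1 -(enum_valK j) rowA trmxK -uE ffunE.
  by rewrite !enum_valK.
have rankM : (\rank M + 1 = m)%N.
  have : \rank (kermx M^T) = 1%N.
    have [v0 _] := card_gt0P V0.
    suff : (kermx M^T == (const_mx 1 : 'rV_m))%MS.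
      move/eqmxP=> ->; apply/eqP; rewrite eqn_leq rank_leq_row lt0n mxrank_eq0.
      apply/eqP => /matrixP/(_ 0 (enum_rank v0)); rewrite !mxE => /eqP.
      by rewrite oner_eq0.
    have cobound (y : 'rV['F_2]_m) f : (y *m M^T) 0 (enum_rank f) =
        y 0 (enum_rank (head f)) + y 0 (enum_rank (tail f)).
      rewrite -(sum_incidence (fun v => y 0 (enum_rank v))) mxE.
      rewrite (reindex_onto enum_rank enum_val) => [|j _]; last exact: enum_valK.
      under eq_bigl do rewrite enum_rankK eqxx.
      by apply: eq_bigr => v _; rewrite !mxE !enum_rankK.
    apply/andP; split.
      apply/row_subP => k.
      have : row k (kermx M^T) *m M^T = 0 by rewrite -row_mul mulmx_ker row0.
      move: (row k _) => y yM; apply/submxP; exists (y 0 (enum_rank v0))%:M.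
      have const v : y 0 (enum_rank v) = y 0 (enum_rank v0).
        have /connectP[q path_q ->] := connG v v0.
        elim: q v path_q => //= w q IHq v /andP[/existsP[f vw] /IHq<-].
        have := cobound y f; rewrite yM mxE => /esym/eqP; rewrite addr_eq0 F2_opp => /eqP ht.
        by case/orP: vw => /andP[/eqP<- /eqP<-].
      rewrite mul_scalar_mx; apply/matrixP=> i j.
      by rewrite ord1 !mxE mulr1 -(const (enum_val j)) enum_valK.
    apply/sub_kermxP/matrixP => i j; rewrite ord1 -(enum_valK j) cobound !mxE.
    exact: F2_addxx.
  rewrite mxrank_ker mxrank_tr; have := rank_leq_col M; lia.
have := mxrank_ker M; rewrite rank_ker /genus -/n -/m; have := rank_leq_row M; lia.
Qed.

End Labelled.

(** * The invariants of a tropical Jacobian *)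

Lemma ffunMzE (I : finType) (w : {ffun I -> int}) (n : int) i : (w *~ n) i = w i * n.
Proof.
have ffunMn k : (w *+ k) i = w i * k%:Z.
  elim: k => [|k IHk]; first by rewrite mulr0n ffunE mulr0.
  by rewrite mulrS ffunE IHk intS mulrDr mulr1.
by case: n => k; rewrite ?NegzE ?mulrNz -pmulrn ?ffunE ffunMn ?mulrN.
Qed.

Lemma colZ_sum g (x : 'cV[int]_g) : x = \sum_i delta_mx i 0 *~ x i 0.
Proof.
rewrite {1}[x]matrix_sum_delta; apply: eq_bigr => i _.
by rewrite big_ord1 -[x i 0 in LHS]intz scaler_int.
Qed.


Section Jacobian.
Variables (R : realType) (g : nat) (Q : 'M[R]_g).
Variables (G : graph) (len : edge G -> R).
Hypothesis len_gt0 : forall f, 0 < len f.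
Variable h : {additive 'cV[int]_g -> {ffun edge G -> int}}.
Hypothesis h_flow : forall y, is_flow y <-> exists x, h x = y.
Hypothesis h_inj : injective h.
Hypothesis h_form : forall x, quadZ Q x = period_form len (h x).
Variable r : 'cV['F_2]_g -> 'cV[int]_g.
Hypothesis r_shortest : forall alpha, shortest_representative Q alpha (r alpha).

Definition coedge2 (f : edge G) : 'cV['F_2]_g :=
  \col_i (h (delta_mx i 0) f)%:~R.

Lemma coedge2P x f : (h x f)%:~R = pairing (coedge2 f) (class2 x).
Proof.
have -> : h x f = \sum_i h (delta_mx i 0) f * x i 0.
  rewrite {1}[x]colZ_sum raddf_sum sum_ffunE; apply: eq_bigr => i _.
  by rewrite raddfMz ffunMzE.
rewrite (big_morph _ (intrD _) (erefl _)) pairingE.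
by apply: eq_bigr => i _; rewrite mxE class2E intrM.
Qed.

Lemma coedge2_cycles (z : {ffun edge G -> 'F_2}) :
  cycle2 z <-> exists alpha, forall f, z f = pairing (coedge2 f) alpha.
Proof.
split=> [/cycle2_signed_flow[y [/h_flow[x <-] <- _]]|[alpha zE]].
  by exists (class2 x) => f; rewrite ffunE coedge2P.
have [x xa] := class2_surj alpha.
have /flow2_cycle2 : is_flow (h x) by apply/h_flow; exists x.
by congr cycle2; apply/ffunP=> f; rewrite ffunE coedge2P xa -zE.
Qed.

(** A flow is nonzero at the odd edges of its class, and some flow of the class has
    coordinates [1] or [-1] there and vanishes elsewhere. *)
Lemma jacobian_minimum alpha :
  quadZ Q (r alpha) = \sum_f len f * (bit (coedge2 f) alpha)%:R.
Proof.
have oddE x f : class2 x = alpha -> bit (coedge2 f) alpha = ((h x f)%:~R != 0 :> 'F_2).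
  by move=> <-; rewrite coedge2P bitE.
have [r_class r_min] := r_shortest alpha.
apply/eqP; rewrite eq_le; apply/andP; split; last first.
  rewrite h_form; apply: ler_sum => f _; rewrite (oddE _ _ r_class).
  rewrite (ler_pM2l (len_gt0 f)) /coedge -rmorphXn /=.
  rewrite pmulrn ler_int; exact: F2_int_sqr.
have /flow2_cycle2/cycle2_signed_flow[y [/h_flow[x xy] y2 y1]] : is_flow (h (r alpha)).
  by apply/h_flow; exists (r alpha).
have x_class : class2 x = alpha.
  have [w wE] : exists w : {ffun edge G -> int}, y - h (r alpha) = w + w.
    have half f : exists n : int, y f - h (r alpha) f = n + n.
      apply: F2_int_half; move/ffunP/(_ f): y2; rewrite !ffunE => yf.
      by rewrite intrB yf subrr.
    have [w wE] := choice half; exists [ffun f => w f].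
    by apply/ffunP=> f; rewrite !ffunE wE.
  have : is_flow w.
    have flow_r : is_flow (h (r alpha)) by apply/h_flow; exists (r alpha).
    have flow_y : is_flow y by apply/h_flow; exists x.
    move/is_flowE: flow_r => flow_r; move/is_flowE: flow_y => flow_y.
    apply/is_flowE => v; have : \sum_f incidence v f * (w + w) f = 0.
      rewrite -wE; under eq_bigr do rewrite !ffunE mulrBr.
      by rewrite sumrB flow_y flow_r subrr.
    under eq_bigr do rewrite ffunE mulrDr; rewrite big_split /=.
    by move: (\sum_f _) => s; lia.
  move=> /h_flow[u hu].
  have -> : x = r alpha + (u + u).
    apply: h_inj; rewrite !raddfD /= hu -wE xy addrC subrK //.
  by rewrite !class2D F2_vec_addxx addr0.
apply: le_trans (r_min x x_class) _; rewrite h_form; apply: ler_sum => f _.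
rewrite (oddE _ _ x_class) (ler_pM2l (len_gt0 f)) /coedge xy.
case: (y1 f) => [->|yf]; first by rewrite expr0n eqxx.
rewrite -rmorphXn /= yf; case: eqP => // /F2_int_half[n yn].
by move: yf; rewrite yn; nia.
Qed.

Let lambda := schottky_lambda (fun alpha => quadZ Q (r alpha)).

Let lambdaE e : e != 0 -> lambda e = \sum_(f | coedge2 f == e) len f.
Proof. by move=> e0; apply: schottky_lambda_weights => //; apply: jacobian_minimum. Qed.

Lemma jacobian_lambda_ge0 e : e != 0 -> 0 <= lambda e.
Proof. by move=> e0; rewrite lambdaE // sumr_ge0 // => f _; apply: ltW. Qed.

Lemma jacobian_cographic :
  cographic (binary_matroid [set e | (e != 0) && (0 < lambda e)]).
Proof.
apply: (labelled_cographic coedge2_cycles) => e; rewrite inE => /andP[e0].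
rewrite lambdaE // => lt0; apply: contrapT => nof; move: lt0.
by rewrite big_pred0 ?ltxx // => f; apply/negbTE/eqP => fe; apply: nof; exists f.
Qed.

End Jacobian.

(** * Labelled graphs and binary cycles *)

(** Halving a nonzero vector decreases the sum of the absolute values. *)
Lemma flow_descent (I : finType) (P : {ffun I -> int} -> Prop) :
  (forall w, P w -> exists2 w', w = w' + w' & P w') -> forall w, P w -> w = 0.
Proof.
move=> half w; have [m] := ubnP (\sum_i absz (w i)); elim: m w => // m IHm w.
move=> /ltnSE-le_m Pw; have [w' wE Pw'] := half w Pw.
have [->|w0] := eqVneq w 0; first by [].
have w'0 : w' != 0 by apply: contra_neq w0 => w'0; rewrite wE w'0 addr0.
rewrite wE (IHm w') ?addr0 //; apply: leq_trans le_m.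
have -> : (\sum_i absz (w i) = \sum_i absz (w' i) + \sum_i absz (w' i))%N.
  by rewrite -big_split; apply: eq_bigr => i _ /=; rewrite wE ffunE; move: (w' i) => n; lia.
have [i w'i] : exists i, w' i != 0.
  apply: contrapT => noi; case/eqP: w'0; apply/ffunP => i; rewrite ffunE.
  by apply/eqP/negPn/negP => wi; apply: noi; exists i.
by rewrite -[X in (X < _)%N]addn0 ltn_add2l (bigD1 i) //= addn_gt0 absz_gt0 w'i.
Qed.

Section Labels.
Variables (g : nat) (E : {set 'cV['F_2]_g}) (G : graph) (phi : edge G -> 'cV['F_2]_g).
Hypothesis phi_inj : injective phi.
Hypothesis phi_im : phi @: setT = E.
Hypothesis phi_rel : forall D : {set edge G},
  \sum_(f in D) phi f = 0 <-> forall z, cycle2 z -> \sum_(f in D) z f = 0.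

Lemma label_in f : phi f \in E.
Proof. by rewrite -phi_im imset_f. Qed.

Lemma label_relation (c : edge G -> 'F_2) :
  \sum_f c f *: phi f = 0 <-> forall z, cycle2 z -> \sum_f c f * z f = 0.
Proof.
pose D := [set f | c f != 0].
have -> : \sum_f c f *: phi f = \sum_(f in D) phi f.
  rewrite [RHS]big_mkcond; apply: eq_bigr => f _; rewrite inE.
  by have [->|/F2_neq0->] := eqVneq (c f) 0; rewrite ?scale0r ?scale1r.
rewrite phi_rel; have sumD (z : edge G -> 'F_2) : \sum_f c f * z f = \sum_(f in D) z f.
  rewrite [RHS]big_mkcond; apply: eq_bigr => f _; rewrite inE.
  by have [->|/F2_neq0->] := eqVneq (c f) 0; rewrite ?mul0r ?mul1r.
by split=> orth z cz; have := orth z cz; rewrite sumD.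
Qed.

(** The values of a binary cycle at the edges labelled by a basis determine [eta], and
    the relation expressing another label through the basis gives the other values. *)
Lemma label_cycles b (alpha : 'I_g -> 'cV['F_2]_g) : dual_family E b alpha ->
  forall z : {ffun edge G -> 'F_2},
    cycle2 z <-> exists eta, forall f, z f = pairing (phi f) eta.
Proof.
move=> dual_ba z; split=> [cz|[eta zE] v]; last first.
  have /label_relation sum0 :
      forall z : {ffun edge G -> 'F_2}, cycle2 z -> \sum_f (incidence v f)%:~R * z f = 0.
    by move=> z' cz'; apply: cz'.
  under eq_bigr do rewrite zE -pairingZl.
  by rewrite -pairing_suml sum0 pairing0l.
have phi_b i : exists f, phi f = b i.
  by have := dual_ba.1 i; rewrite -phi_im => /imsetP[f _ ->]; exists f.
have [fb fbE] := choice phi_b.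
exists (\sum_i z (fb i) *: alpha i) => f.
pose c f' := (f' == f)%:R + \sum_(i | fb i == f') pairing (phi f) (alpha i).
have sum_c (V : lmodType 'F_2) (F : edge G -> V) : \sum_f' c f' *: F f' =
    F f + \sum_i pairing (phi f) (alpha i) *: F (fb i).
  under eq_bigr do rewrite scalerDl; rewrite big_split /=; congr (_ + _).
    rewrite (bigD1 f) //= eqxx scale1r big1 ?addr0 // => f' /negPf->.
    by rewrite scale0r.
  under eq_bigr do rewrite scaler_suml.
  rewrite (exchange_big_dep xpredT) //=; apply: eq_bigr => i _.
  by rewrite (big_pred1 (fb i)) // => f'; rewrite /= eq_sym.
have rel_c : \sum_f' c f' *: phi f' = 0.
  rewrite sum_c; apply: pairing_inj => eta; rewrite pairing0l pairingDl pairing_suml.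
  rewrite {1}[eta](dual_family_expand dual_ba) pairing_sumr -big_split big1 //= => i _.
  by rewrite fbE pairingZl pairingZr mulrC F2_addxx.
move/label_relation/(_ z cz): rel_c.
have -> : \sum_f' c f' * z f' = z f + \sum_i pairing (phi f) (alpha i) * z (fb i).
  exact: (sum_c (GRing.regular 'F_2) z).
move/eqP; rewrite addr_eq0 F2_opp => /eqP->; rewrite pairing_sumr.
by apply: eq_bigr => i _; rewrite pairingZr mulrC.
Qed.

End Labels.

(** * Realizing the covectors as flows of the graph *)

Section Realization.
Variables (R : realType) (g : nat) (Q : 'M[R]_g).
Hypothesis hQ : posdef Q.
Variables (E : {set 'cV['F_2]_g}) (lambda : 'cV['F_2]_g -> R).
Hypothesis lambda_gt0 : forall e, e \in E -> 0 < lambda e.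
Variable r : 'cV['F_2]_g -> 'cV[int]_g.
Hypothesis r_shortest : forall alpha, shortest_representative Q alpha (r alpha).
Hypothesis r_weight : forall alpha, quadZ Q (r alpha) = weight E lambda alpha.
Variable a : 'cV['F_2]_g -> 'cV[int]_g.
Hypothesis a_class : forall e, e \in E -> class2 (a e) = e.
Hypothesis a_squares :
  forall x, quadZ Q x = \sum_(e in E) lambda e * (pairing (a e) x)%:~R ^+ 2.
Variables (G : graph) (phi : edge G -> 'cV['F_2]_g).
Hypothesis phi_inj : injective phi.
Hypothesis phi_im : phi @: setT = E.
Hypothesis phi_rel : forall D : {set edge G},
  \sum_(f in D) phi f = 0 <-> forall z, cycle2 z -> \sum_(f in D) z f = 0.

Let phi_in f : phi f \in E.
Proof. exact: label_in phi_im f. Qed.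

Let cov f := a (phi f).

Lemma incidence_F2 (v : vertex G) (f : edge G) :
  (incidence v f)%:~R = (incidence v f != 0)%:R :> 'F_2.
Proof.
by rewrite /incidence; case: (_ == _); case: (_ == _); apply/val_inj.
Qed.

(** The edges at a vertex form a cut, so their labels sum to zero. *)
Lemma star_signs (v : vertex G) : exists eps : edge G -> int,
  (forall f, incidence v f != 0 -> eps f = 1 \/ eps f = -1) /\
  \sum_(f | incidence v f != 0) eps f *: cov f = 0.
Proof.
pose D := [set f | incidence v f != 0].
have sumD : \sum_(e in phi @: D) e = 0.
  rewrite big_imset /=; last by move=> f f' _ _; apply: phi_inj.
  apply/phi_rel => z cz; rewrite -[RHS](cz v) big_mkcond; apply: eq_bigr => f _.
  by rewrite inE incidence_F2; case: (_ != _); rewrite ?mul1r ?mul0r.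
have subE : phi @: D \subset E by rewrite -phi_im imsetS ?subsetT.
have [eps [eps1 eps0]] := covector_relation hQ lambda_gt0 r_shortest r_weight
  a_class a_squares subE sumD.
exists (fun f => eps (phi f)); split=> [f vf|].
  by apply: eps1; apply: imset_f; rewrite inE.
rewrite -[RHS]eps0 big_imset /=; last by move=> f f' _ _; apply: phi_inj.
by apply: eq_bigl => f; rewrite inE.
Qed.

Definition edge_coords (S : edge G -> int) (x : 'cV[int]_g) : {ffun edge G -> int} :=
  [ffun f => S f * pairing (cov f) x].

(** Adding up the relations of all stars, each edge whose two signs agree appears
    with coefficient [2] or [-2], and the other edges cancel.  Halving gives a
    relation, which is orthogonal modulo 2 to the cycles; so the edges with equal
    signs form a cut.  Changing the signs of the stars on one side of this cut makes
    the two signs of every edge opposite, as in the boundary of an oriented edge. *)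
Lemma ex_orientation : exists S : edge G -> int,
  (forall f, S f = 1 \/ S f = -1) /\ forall x, is_flow (edge_coords S x).
Proof.
have [eps epsP] := choice star_signs.
have eps1 v f : incidence v f != 0 -> eps v f = 1 \/ eps v f = -1.
  exact: (epsP v).1.
pose eps' v f := if incidence v f != 0 then eps v f else 0.
have eps'0 v : \sum_f eps' v f *: cov f = 0.
  rewrite -[RHS](epsP v).2 [RHS]big_mkcond; apply: eq_bigr => f _.
  by rewrite /eps'; case: ifP; rewrite ?scale0r.
have incN v f : v != head f -> v != tail f -> incidence v f = 0.
  by rewrite /incidence ![v == _]eq_sym => /negPf-> /negPf->.
have sum_eps f : \sum_v eps' v f =
    if head f == tail f then 0 else eps (head f) f + eps (tail f) f.
  have [loop|nl] := eqVneq (head f) (tail f).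
    by rewrite big1 // => v _; rewrite /eps' /incidence loop subrr eqxx.
  rewrite (bigD1 (head f)) //= (bigD1 (tail f)) 1?eq_sym //= big1 => [|v /andP[vh vt]].
    rewrite addr0 /eps' /incidence eqxx [tail f == _]eq_sym (negPf nl) eqxx /=.
    by [].
  by rewrite /eps' incN.
have inc_head f : head f != tail f -> incidence (head f) f = 1.
  by rewrite /incidence eqxx [tail f == _]eq_sym => /negPf->.
have inc_tail f : head f != tail f -> incidence (tail f) f = -1.
  by rewrite /incidence eqxx => /negPf->.
have half f : exists k : int, \sum_v eps' v f = k + k.
  rewrite sum_eps; have [loop|nl] := eqVneq (head f) (tail f); first by exists 0.
  have [|->|->] := eps1 (head f) f; first by rewrite inc_head.
    have [|->|->] := eps1 (tail f) f; first by rewrite inc_tail.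
      by exists 1.
    by exists 0.
  have [|->|->] := eps1 (tail f) f; first by rewrite inc_tail.
    by exists 0.
  by exists (-1).
have [k kE] := choice half.
have rel_k : \sum_f k f *: cov f = 0.
  have : \sum_f k f *: cov f + \sum_f k f *: cov f = 0.
    rewrite -big_split /=; under eq_bigr do rewrite -scalerDl -kE scaler_suml.
    by rewrite exchange_big big1 // => v _; apply: eps'0.
  move: (\sum_f _) => s /matrixP s0; apply/matrixP=> i j; have := s0 i j.
  by rewrite !mxE; move: (s i j) => n; lia.
have [c cE] : exists c : vertex G -> 'F_2, forall f,
    (k f)%:~R = c (head f) + c (tail f).
  apply/cycle2_orthogonal; apply/(label_relation phi_rel).
  apply: pairing_inj => eta; have [x <-] := class2_surj eta.
  rewrite pairing0l pairing_suml; move/(congr1 (fun v => (pairing v x)%:~R : 'F_2)): rel_k.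
  rewrite pairing0l pairing_suml (big_morph _ (intrD _) (erefl _)) => rel_k.
  rewrite -[RHS]rel_k; apply: eq_bigr => f _.
  by rewrite !pairingZl intrM -[phi f in LHS]a_class // pairing_class2.
pose sigma v : int := if c v != 0 then -1 else 1.
pose S f := if head f == tail f then 1 else eps (head f) f * sigma (head f).
have sigma1 v : sigma v = 1 \/ sigma v = -1 by rewrite /sigma; case: ifP; auto.
have S_inc v f : eps' v f = sigma v * (S f * incidence v f).
  rewrite /S; have [loop|nl] := eqVneq (head f) (tail f).
    by rewrite /eps' /incidence loop subrr eqxx !mulr0.
  have [->|vh] := eqVneq v (head f).
    rewrite /eps' inc_head //= mulr1 mulrCA.
    by case: (sigma1 (head f)) => ->; rewrite ?mulrNN !mulr1.
  have [->|vt] := eqVneq v (tail f); last by rewrite /eps' incN // eqxx !mulr0.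
  rewrite /eps' inc_tail //=.
  have /(congr1 (fun u : 'F_2 => u != 0)) := cE f; rewrite F2_addb F2_int_eq0.
  have := kE f; rewrite sum_eps (negPf nl) /sigma; move: (k f) => n.
  have eps_h : eps (head f) f = 1 \/ eps (head f) f = -1 by apply: eps1; rewrite inc_head.
  have eps_t : eps (tail f) f = 1 \/ eps (tail f) f = -1 by apply: eps1; rewrite inc_tail.
  case: eps_h => ->; case: eps_t => ->;
  by case: (c (head f) != 0); case: (c (tail f) != 0) => /= *; lia.
exists S; split=> [f|x].
  rewrite /S; case: eqP => [_|/eqP nl]; first by left.
  have eps_h : eps (head f) f = 1 \/ eps (head f) f = -1 by apply: eps1; rewrite inc_head.
  by case: eps_h => ->; case: (sigma1 (head f)) => ->; auto.
apply/is_flowE => v; have sigma0 : sigma v != 0 by case: (sigma1 v) => ->.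
apply: (mulfI sigma0); rewrite mulr0 mulr_sumr -[RHS](pairing0l x) -(eps'0 v).
rewrite pairing_suml; apply: eq_bigr => f _.
by rewrite ffunE pairingZl S_inc; ring.
Qed.

Section Oriented.
Variable S : edge G -> int.
Hypothesis S1 : forall f, S f = 1 \/ S f = -1.
Hypothesis S_flow : forall x, is_flow (edge_coords S x).

Let SS f : S f * S f = 1.
Proof. by case: (S1 f) => ->. Qed.

Lemma edge_coordsB x y : edge_coords S (x - y) = edge_coords S x - edge_coords S y.
Proof. by apply/ffunP=> f; rewrite !ffunE pairingDr pairingNr mulrBr. Qed.

Lemma edge_coords_form x :
  quadZ Q x = period_form (fun f => lambda (phi f)) (edge_coords S x).
Proof.
rewrite a_squares -phi_im big_imset /=; last by move=> f f' _ _; apply: phi_inj.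
rewrite big_mkcond; apply: eq_bigr => f _; rewrite in_setT /coedge ffunE.
by case: (S1 f) => ->; rewrite ?mulN1r ?mul1r ?intrN ?sqrrN.
Qed.

Lemma edge_coords_inj : injective (edge_coords S).
Proof.
move=> x y xy; apply/eqP; rewrite -subr_eq0; apply/eqP/(quadZ_eq0 hQ).
rewrite edge_coords_form edge_coordsB xy subrr /period_form big1 // => f _.
by rewrite /coedge ffunE expr0n mulr0.
Qed.

Let ex_dual : exists b (alpha : 'I_g -> 'cV['F_2]_g), dual_family E b alpha.
Proof. exact: ex_dual_family (spanning_support hQ r_shortest r_weight). Qed.

(** The coordinates at the edges labelled by a basis can be prescribed, and a flow
    that vanishes at these edges is divisible by 2 indefinitely. *)
Lemma edge_coords_surj y : is_flow y -> exists x, edge_coords S x = y.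
Proof.
move=> flow_y; have [b [alpha dual_ba]] := ex_dual.
have phi_b i : exists f, phi f = b i.
  by have := dual_ba.1 i; rewrite -phi_im => /imsetP[f _ ->]; exists f.
have [fb fbE] := choice phi_b.
have dual1 i := covector_dual1 lambda_gt0 r_shortest r_weight a_class a_squares dual_ba i.
have dual0 := covector_dual lambda_gt0 r_shortest r_weight a_class a_squares dual_ba.
pose n i := S (fb i) * y (fb i) * pairing (a (b i)) (r (alpha i)).
pose x := \sum_i n i *: r (alpha i); exists x; apply/esym/eqP; rewrite -subr_eq0; apply/eqP.
pose P w := is_flow w /\ forall i, w (fb i) = 0.
have subE f : (y - edge_coords S x) f = y f - edge_coords S x f by rewrite !ffunE.
apply: (@flow_descent _ P) => [w [flow_w w0]|]; last first.
  split=> [|i].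
    move/is_flowE: flow_y => flow_y; have /is_flowE flow_x := S_flow x.
    apply/is_flowE => v; under eq_bigr do rewrite subE mulrBr.
    by rewrite sumrB flow_y flow_x subrr.
  rewrite subE ffunE /cov fbE /x pairing_sumr (bigD1 i) //= big1 => [|j ji]; last first.
    by rewrite pairingZr dual0 ?mulr0 // eq_sym.
  rewrite pairingZr addr0 /n.
  have := SS (fb i); case: (dual1 i) => ->; move: (S _) (y _) => s t ss.
    by rewrite !mulr1 mulrA ss mul1r subrr.
  by rewrite !mulrN1 opprK mulrA ss mul1r subrr.
have [w' w'E] : exists w' : {ffun edge G -> int}, w = w' + w'.
  have [eta etaE] := (label_cycles phi_im phi_rel dual_ba _).1 (flow2_cycle2 flow_w).
  have eta0 : eta = 0.
    apply: (dual_family_eq0 dual_ba) => i; apply/bitP.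
    by rewrite -fbE -etaE ffunE w0.
  have half f : exists m : int, w f = m + m.
    by apply: F2_int_half; have := etaE f; rewrite ffunE eta0 pairing0r.
  have [w' w'E] := choice half; exists [ffun f => w' f].
  by apply/ffunP=> f; rewrite !ffunE w'E.
exists w' => //; split=> [|i]; last first.
  by move/ffunP/(_ (fb i)): w'E; rewrite w0 ffunE; move: (w' (fb i)) => k; lia.
move/is_flowE: flow_w => flow_w; apply/is_flowE => v; have := flow_w v.
rewrite w'E; under eq_bigr do rewrite ffunE mulrDr; rewrite big_split /=.
by move: (\sum_f _) => s; lia.
Qed.

Lemma realization_genus : connected_graph G -> genus G = g%:Z.
Proof.
move=> connG; have [b [alpha dual_ba]] := ex_dual.
apply: (labelled_genus (label_cycles phi_im phi_rel dual_ba)) => // eta eta0.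
apply: (spanning_support hQ r_shortest r_weight) => e.
by rewrite -phi_im => /imsetP[f _ ->]; apply/bitP.
Qed.

Lemma realization_locus : connected_graph G -> tropical_jacobian_locus Q.
Proof.
move=> connG; split=> //; exists G, (fun f => lambda (phi f)).
split; [by split=> // f; apply: lambda_gt0 | exact: realization_genus |].
pose hA := GRing.isZmodMorphism.Build _ _ _ edge_coordsB.
pose h : {additive 'cV[int]_g -> {ffun edge G -> int}} := HB.pack (edge_coords S) hA.
exists h; split; first exact: edge_coords_inj.
  move=> y; split=> [/edge_coords_surj[x <-]|[x <-]]; first by exists x.
  exact: S_flow.
exact: edge_coords_form.
Qed.

Lemma edge_coords_sum x :
  edge_coords S x = \sum_i edge_coords S (delta_mx i 0) *~ x i 0.
Proof.
apply/ffunP=> f; rewrite ffunE {1}[x]colZ_sum pairing_sumr mulr_sumr sum_ffunE.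
apply: eq_bigr => i _; rewrite ffunMzE ffunE -mulrA; congr (_ * _).
by rewrite -scaler_int pairingZr intz mulrC.
Qed.

Lemma realization_basis :
  integral_cycle_basis (fun i : 'I_g => edge_coords S (delta_mx i 0)).
Proof.
split=> [i|y /edge_coords_surj[x <-]]; first exact: S_flow.
exists [ffun i => x i 0]; split=> [|n].
  by rewrite {1}edge_coords_sum; apply: eq_bigr => i _; rewrite ffunE.
pose x' : 'cV[int]_g := \col_i n i.
have -> : \sum_(i < g) edge_coords S (delta_mx i 0) *~ n i = edge_coords S x'.
  by rewrite [RHS]edge_coords_sum; apply: eq_bigr => i _; rewrite mxE.
by move/edge_coords_inj=> ->; apply/ffunP=> i; rewrite ffunE mxE.
Qed.

(** Being a basis of the flows, [b] differs from the flows of the standard basis of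
    the lattice by a unimodular matrix. *)
Lemma realization_transition (b : 'I_g -> {ffun edge G -> int}) :
  integral_cycle_basis b ->
  exists2 U : 'M[int]_g, U \in unitmx &
    \matrix_(i, j) cov (enum_val j) i 0 = U *m coedge_matrix b *m edge_diag S.
Proof.
move=> [flow_b basis_b].
have ex_n k : exists m : {ffun 'I_g -> int},
    edge_coords S (delta_mx k 0) = \sum_i b i *~ m i.
  by have [m [mE _]] := basis_b _ (S_flow (delta_mx k 0)); exists m.
have [n nE] := choice ex_n.
have [x xE] := choice (fun i => edge_coords_surj (flow_b i)).
pose U : 'M[int]_g := \matrix_(k, i) n k i.
pose Y : 'M[int]_g := \matrix_(i, k) x i k 0.
have YU : Y *m U = 1%:M.
  apply/matrixP=> i j.
  have [m [_ m_uniq]] := basis_b _ (flow_b i).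
  have m1 : m = [ffun k => (k == i)%:Z].
    apply: m_uniq; rewrite (bigD1 i) //= ffunE eqxx big1 ?addr0 // => k /negPf ki.
    by rewrite ffunE ki mulr0z.
  have m2 : m = [ffun k => (Y *m U) i k].
    apply: m_uniq; rewrite -{1}xE edge_coords_sum.
    under eq_bigr do rewrite nE.
    apply/ffunP=> f; rewrite !sum_ffunE.
    under eq_bigr do rewrite ffunMzE sum_ffunE mulr_suml.
    rewrite exchange_big; apply: eq_bigr => k _ /=.
    rewrite ffunMzE ffunE mxE mulr_sumr; apply: eq_bigr => l _.
    by rewrite ffunMzE !mxE; ring.
  have := congr1 (fun m : {ffun _} => m j) (etrans (esym m2) m1).
  by rewrite !ffunE => ->; rewrite [RHS]mxE eq_sym; case: eqP.
exists U; first by have := mulmx1_unit YU; case.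
apply/matrixP=> k j; rewrite /edge_diag mul_mx_diag !mxE.
have /ffunP/(_ (enum_val j)) := nE k; rewrite ffunE sum_ffunE pairing_delta => kE.
rewrite -[LHS]mul1r -(SS (enum_val j)) -mulrA kE mulrC; congr (_ * _).
by apply: eq_bigr => i _; rewrite !mxE ffunMzE mulrC.
Qed.

End Oriented.

End Realization.

(** * Correctness of the two algorithms *)

Lemma ex_shortest_representative (R : realType) g (Q : 'M[R]_g) : posdef Q ->
  exists r : 'cV['F_2]_g -> 'cV[int]_g,
    forall alpha, shortest_representative Q alpha (r alpha).
Proof.
move=> hQ; have ex alpha : exists x, shortest_representative Q alpha x.
  by have [x xa xmin] := quadZ_argmin hQ (class2_surj alpha); exists x.
by have [r hr] := choice ex; exists r.
Qed.

Lemma locus_cographic (R : realType) g (Q : 'M[R]_g) r :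
  (forall alpha, shortest_representative Q alpha (r alpha)) ->
  let lambda := schottky_lambda (fun alpha => quadZ Q (r alpha)) in
  tropical_jacobian_locus Q ->
  (forall e, e != 0 -> 0 <= lambda e) /\
  cographic (binary_matroid [set e | (e != 0) && (0 < lambda e)]).
Proof.
move=> hr lambda [_ [G [len [[_ len0] _ [h [h_inj h_flow h_form]]]]]]; split.
  exact: (jacobian_lambda_ge0 len0 h_flow h_inj h_form hr).
exact: (jacobian_cographic len0 h_flow h_inj h_form hr).
Qed.

Lemma nonneg_weight (R : realType) g (Q : 'M[R]_g) r : posdef Q ->
  (forall alpha, shortest_representative Q alpha (r alpha)) ->
  let lambda := schottky_lambda (fun alpha => quadZ Q (r alpha)) in
  (forall e, e != 0 -> 0 <= lambda e) ->
  forall alpha,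
    quadZ Q (r alpha) = weight [set e | (e != 0) && (0 < lambda e)] lambda alpha.
Proof.
move=> hQ hr lambda lambda0 alpha.
have r0 : quadZ Q (r 0) = 0.
  apply/eqP; rewrite eq_le quadZ_ge0 // andbT.
  by have [_ min0] := hr 0; rewrite -(quadZ0 Q); apply: min0; apply: class2_0.
rewrite (schottky_inversion (fun alpha => quadZ Q (r alpha))) r0 add0r weightE.
rewrite [RHS]big_mkcond; apply: eq_bigr => e _; rewrite inE -/lambda.
have [->|e0] /= := eqVneq e 0; first by rewrite bitC bit0 mulr0.
case: ltP => // le0; suff -> : lambda e = 0 by rewrite mul0r.
by apply/eqP; rewrite eq_le le0 lambda0.
Qed.

(** Polarization at pairs of unit vectors. *)
Lemma squares_matrix (R : realType) g (Q : 'M[R]_g) (I : finType) (P : pred I)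
    (len : I -> R) (a : I -> 'cV[int]_g) : posdef Q ->
  (forall x, quadZ Q x = \sum_(e | P e) len e * (pairing (a e) x)%:~R ^+ 2) ->
  forall i k, Q i k = \sum_(e | P e) len e * ((a e i 0)%:~R * (a e k 0)%:~R).
Proof.
move=> hQ sq i k; pose x : 'cV[int]_g := delta_mx i 0; pose y : 'cV[int]_g := delta_mx k 0.
have two : 2 * bform Q x y = quadZ Q (x + y) - quadZ Q x - quadZ Q y.
  by rewrite !quadZE !bformE // (bformC hQ y x); ring.
have : 2 * Q i k = 2 * \sum_(e | P e) len e * ((a e i 0)%:~R * (a e k 0)%:~R).
  rewrite -bform_delta two !sq -!sumrB mulr_sumr; apply: eq_bigr => e _.
  by rewrite pairingDr !pairing_delta intrD; ring.
by apply: mulfI; rewrite pnatr_eq0.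
Qed.

Lemma reorient_flow (G : graph) (eps : edge G -> int) (x : {ffun edge G -> int}) :
  (forall f, eps f = 1 \/ eps f = -1) ->
  @is_flow (reorient eps) x <-> is_flow [ffun f => eps f * x f].
Proof.
move=> eps1; have incE (v : vertex G) (f : edge G) :
    @incidence (reorient eps) v f * x f = @incidence G v f * [ffun f => eps f * x f] f.
  rewrite ffunE mulrA; congr (_ * _); rewrite /incidence /=.
  have m1 : (-1 == 1 :> int) = false by [].
  by case: (eps1 f) => ->; rewrite ?eqxx ?m1 /= ?mulr1 // mulrN1 opprB.
split=> /is_flowE flow; apply/is_flowE => v; rewrite -[RHS](flow v);
  by apply: eq_bigr => f _; rewrite incE.
Qed.

Lemma reorient_connected (G : graph) (eps : edge G -> int) :
  connected_graph G -> connected_graph (reorient eps).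
Proof.
move=> [V0 connG]; split=> // u v; apply: (homo_connect (h := id)) (connG u v) => {}u {}v.
move=> /existsP[f fuv]; apply/existsP; exists f; rewrite /=.
by case: (eps f == 1); rewrite // orbC andbC [X in _ || X]andbC.
Qed.

Lemma reorient_basis (G : graph) (eps : edge G -> int) g (U : 'M[int]_g)
    (b : 'I_g -> {ffun edge G -> int})
    (b' : 'I_g -> {ffun edge (reorient eps) -> int}) :
  (forall f, eps f = 1 \/ eps f = -1) -> U \in unitmx -> integral_cycle_basis b ->
  (forall i (f : edge G), eps f * b' i f = \sum_j U i j * b j f) ->
  integral_cycle_basis b'.
Proof.
move=> eps1 unitU [flow_b basis_b] b'E.
pose twist (x : {ffun edge (reorient eps) -> int}) : {ffun edge G -> int} :=
  [ffun f => eps f * x f].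
have twist_inj : injective twist.
  move=> x y /ffunP xy; apply/ffunP=> f; have := xy f; rewrite !ffunE.
  by case: (eps1 f) => ->; rewrite ?mul1r // !mulN1r => /oppr_inj.
have twistE (n : 'I_g -> int) : twist (\sum_i b' i *~ n i) =
    \sum_j b j *~ ((\row_i n i) *m U) 0 j.
  apply/ffunP=> f; rewrite ffunE !sum_ffunE mulr_sumr.
  under eq_bigr do rewrite ffunMzE mulrA b'E mulr_suml.
  rewrite exchange_big; apply: eq_bigr => j _ /=; rewrite ffunMzE mxE mulr_sumr.
  by apply: eq_bigr => i _; rewrite mxE; ring.
split=> [i|x /(reorient_flow _ eps1) flow_x].
  apply/(reorient_flow _ eps1)/is_flowE => v.
  under eq_bigr do rewrite ffunE b'E mulr_sumr.
  rewrite exchange_big big1 // => j _ /=; have /is_flowE/(_ v) := flow_b j.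
  under eq_bigr do rewrite mulrCA.
  by rewrite -mulr_sumr => ->; rewrite mulr0.
have [m [xm m_uniq]] := basis_b _ flow_x.
have rowK (n : {ffun 'I_g -> int}) j : (\row_i n i) 0 j = n j by rewrite mxE.
pose n : {ffun 'I_g -> int} := [ffun i => ((\row_j m j) *m invmx U) 0 i].
have rown : \row_i n i = (\row_j m j) *m invmx U.
  by apply/rowP=> i; rewrite mxE ffunE.
exists n; split=> [|n' xn'].
  apply: twist_inj; rewrite twistE rown mulmxKV //.
  by rewrite /twist xm; apply: eq_bigr => j _; rewrite rowK.
have m_n' : m = [ffun j => ((\row_i n' i) *m U) 0 j].
  apply: m_uniq; rewrite -/(twist x) xn' twistE.
  by apply: eq_bigr => j _; rewrite ffunE.
apply/ffunP=> i; rewrite ffunE.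
have -> : \row_j m j = (\row_i n' i) *m U.
  by apply/rowP=> j; rewrite mxE m_n' ffunE.
by rewrite mulmxK // mxE.
Qed.

Section Recovery.
Variables (R : realType) (g : nat) (Q : 'M[R]_g).
Hypothesis hQ : posdef Q.
Variables (E : {set 'cV['F_2]_g}) (lambda : 'cV['F_2]_g -> R).
Hypothesis lambda_gt0 : forall e, e \in E -> 0 < lambda e.
Hypothesis E0 : 0 \notin E.
Variable r : 'cV['F_2]_g -> 'cV[int]_g.
Hypothesis r_shortest : forall alpha, shortest_representative Q alpha (r alpha).
Hypothesis r_weight : forall alpha, quadZ Q (r alpha) = weight E lambda alpha.
Variables (G : graph) (phi : edge G -> 'cV['F_2]_g).
Hypothesis connG : connected_graph G.
Hypothesis isoG :
  matroid_iso (dual_matroid (graphic_matroid G)) (binary_matroid E) phi.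

Let phi_inj : injective phi. Proof. by have [] := (matroid_isoP E phi).1 isoG. Qed.
Let phi_im : phi @: setT = E. Proof. by have [] := (matroid_isoP E phi).1 isoG. Qed.
Let phi_rel : forall D : {set edge G},
  \sum_(f in D) phi f = 0 <-> forall z, cycle2 z -> \sum_(f in D) z f = 0.
Proof. by have [] := (matroid_isoP E phi).1 isoG. Qed.
Let spanE := spanning_support hQ r_shortest r_weight.

Lemma decision_sound : tropical_jacobian_locus Q.
Proof.
have [a [a_class a_squares]] := sum_of_squares hQ lambda_gt0 r_shortest r_weight.
have [S [S1 S_flow]] := ex_orientation hQ lambda_gt0 r_shortest r_weight a_class a_squares
  phi_inj phi_im phi_rel.
exact: (realization_locus hQ lambda_gt0 r_shortest r_weight a_class a_squares
  phi_inj phi_im phi_rel S1 S_flow).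
Qed.

Lemma ex_basis_with e : e \in E ->
  exists B : {set 'cV['F_2]_g}, matroid_basis (binary_matroid E) B /\ e \in B.
Proof.
move=> eE; have [|B subB basisB] := @ex_matroid_basis _ (binary_matroid E) [set e].
  split; first by rewrite sub1set.
  apply/F2_free_setP => D; rewrite subset1 => /orP[/eqP->|/eqP-> //].
  by rewrite big_set1 => e0; rewrite e0 (negPf E0) in eE.
by exists B; split=> //; rewrite -sub1set.
Qed.

Lemma ex_dual_vectors (B : {set 'cV['F_2]_g}) :
  matroid_basis (binary_matroid E) B ->
  exists alpha : 'cV['F_2]_g -> 'cV['F_2]_g,
    forall b b', b \in B -> b' \in B -> pairing b' (alpha b) = (b == b')%:R.
Proof.
move=> basisB; have [b [al [dual_ba memB]]] := matroid_basis_dual spanE basisB.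
exists (fun x => \sum_i (b i == x)%:R *: al i) => _ _ /memB[j ->] /memB[k ->].
have injb := inj_eq (dual_family_injective dual_ba).
rewrite (bigD1 j) //= eqxx scale1r big1 ?addr0 => [|i /negPf ij].
  by rewrite pairing_bit dual_ba.2 injb eq_sym.
by rewrite injb ij scale0r.
Qed.

(** The description by indexed families of the basis, dual vectors and span that the
    algorithm handles as sets. *)
Lemma basis_family (B : {set 'cV['F_2]_g}) (alpha : 'cV['F_2]_g -> 'cV['F_2]_g) e :
  matroid_basis (binary_matroid E) B -> e \in B ->
  (forall b b', b \in B -> b' \in B -> pairing b' (alpha b) = (b == b')%:R) ->
  exists (b : 'I_g -> 'cV['F_2]_g) i,
    [/\ dual_family E b (fun k => alpha (b k)), b i = e &
      forall x, inIntSpan [seq r (alpha b') | b' <- enum (B :\ e)] x <->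
        exists n : 'I_g -> int, x = \sum_(k | k != i) n k *: r (alpha (b k))].
Proof.
move=> basisB eB halpha; have [b [al [dual_ba memB]]] := matroid_basis_dual spanE basisB.
have injb := dual_family_injective dual_ba.
have bB i : b i \in B by apply/memB; exists i.
have [i ei] := (memB e).1 eB; exists b, i; split=> [||x]; rewrite ?ei //.
  split=> [k|k j]; first exact: dual_ba.1.
  by rewrite bitE halpha // (inj_eq injb) [j == k]eq_sym; case: (k == j).
have sumB (V : zmodType) (F : 'cV['F_2]_g -> V) :
    \sum_(b' in B :\ b i) F b' = \sum_(k | k != i) F (b k).
  transitivity (\sum_(b' in [set b k | k in [set k | k != i]]) F b').
    apply: eq_bigl => b'; rewrite !inE; apply/andP/imsetP => [[ne /memB[k b'k]]|[k]].
      by exists k; rewrite // inE; apply: contraNneq ne => <-; rewrite b'k.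
    by rewrite inE => ki ->; rewrite (inj_eq injb).
  rewrite big_imset /=; last by move=> k k' _ _; apply: injb.
  by apply: eq_bigl => k; rewrite inE.
rewrite inIntSpan_enum; split=> [[n ->]|[n ->]].
  exists (fun k => n (b k)); rewrite sumB; apply: eq_bigr => k _.
  by rewrite -scaler_int intz.
exists (fun b' => \sum_(k | b k == b') n k); rewrite sumB; apply: eq_bigr => k _.
rewrite -scaler_int intz (big_pred1 k) // => k'; exact: inj_eq.
Qed.

(** By [covector_unique], the covectors that were picked are those of
    [sum_of_squares] up to sign, so that they have the same properties and are realized
    by the graph, whatever cycle basis is picked.  As [A = U C S], the output basis
    consists of the rows of [A]. *)
Theorem recovery_correct :
  always_outputs (schottky_recovery (RetainedData E lambda r phi))
    (fun Gam : recovery_output R g =>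
      [/\ is_metric_graph (out_len Gam), integral_cycle_basis (out_basis Gam)
        & riemann_matrix (out_len Gam) (out_basis Gam) = Q]).
Proof.
rewrite /schottky_recovery /=; split.
  have ex e : exists B : {set 'cV['F_2]_g}, e \in E ->
      matroid_basis (binary_matroid E) B /\ e \in B.
    have [eE|_] := boolP (e \in E); last by exists set0.
    by have [B hB] := ex_basis_with eE; exists B.
  by have [B hB] := choice ex; exists B.
move=> B hB; split.
  have ex e : exists al : 'cV['F_2]_g -> 'cV['F_2]_g, e \in E ->
      forall b b', b \in B e -> b' \in B e -> pairing b' (al b) = (b == b')%:R.
    have [eE|_] := boolP (e \in E); last by exists id.
    by have [al hal] := ex_dual_vectors (hB e eE).1; exists al.
  by have [al hal] := choice ex; exists al.
move=> alpha halpha.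
have [a [a_class a_squares]] := sum_of_squares hQ lambda_gt0 r_shortest r_weight.
have family e (eE : e \in E) := basis_family (hB e eE).1 (hB e eE).2 (halpha e eE).
split.
  exists a => e eE; have [b [i [dual_ba ei spanP]]] := family e eE.
  rewrite -{1 2}ei; split.
    exact: (covector_primitive lambda_gt0 r_shortest r_weight a_class a_squares dual_ba).
  move=> x; rewrite spanP.
  exact: (covector_kernel hQ lambda_gt0 r_shortest r_weight a_class a_squares dual_ba).
move=> a' ha'.
have a'E e : e \in E -> a' e = a e \/ a' e = - a e.
  move=> eE; have [b [i [dual_ba ei spanP]]] := family e eE.
  have [prim_a' ker_a'] := ha' e eE; rewrite -[in a e]ei.
  apply: (covector_unique hQ lambda_gt0 r_shortest r_weight a_class a_squares
    dual_ba) => // k ki.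
  apply/ker_a'/spanP; exists (fun j => (j == k)%:Z).
  rewrite (bigD1 k) //= eqxx scale1r big1 ?addr0 // => j /andP[_ /negPf->].
  by rewrite scale0r.
have a'_class e : e \in E -> class2 (a' e) = e.
  by move=> eE; case: (a'E e eE) => ->; rewrite ?class2N a_class.
have a'_squares x : quadZ Q x = \sum_(e in E) lambda e * (pairing (a' e) x)%:~R ^+ 2.
  rewrite a_squares; apply: eq_bigr => e eE; congr (_ * _).
  by case: (a'E e eE) => ->; rewrite ?pairingNl ?intrN ?sqrrN.
have [S [S1 S_flow]] := ex_orientation hQ lambda_gt0 r_shortest r_weight a'_class a'_squares
  phi_inj phi_im phi_rel.
split.
  have basis := realization_basis hQ lambda_gt0 r_shortest r_weight a'_class a'_squares
    phi_inj phi_im phi_rel S1 S_flow.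
  by eexists; eexists; [exact: basis | reflexivity].
move=> C [b basis_b ->]; split.
  have [U unitU AE] := realization_transition hQ lambda_gt0 r_shortest r_weight a'_class
    a'_squares phi_im phi_rel S1 S_flow basis_b.
  by exists (U, S).
move=> [U eps] /= [unitU eps1 AE].
have outE i f : (U *m (coedge_matrix b *m edge_diag eps)) i (enum_rank f) = a' (phi f) i 0.
  by rewrite mulmxA -AE mxE enum_rankK.
have phi_in f : phi f \in E by rewrite -phi_im imset_f.
split.
- by split; [exact: reorient_connected | move=> f; apply: lambda_gt0].
- apply: (reorient_basis eps1 unitU basis_b) => i f.
  rewrite ffunE mulmxA /edge_diag mul_mx_diag !mxE enum_rankK mulrC -mulrA.
  have -> : eps f * eps f = 1 by case: (eps1 f) => ->.
  by rewrite mulr1; apply: eq_bigr => j _; rewrite mxE enum_rankK.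
apply/matrixP=> i k; rewrite /riemann_matrix /edge_diag mul_mx_diag mxE.
rewrite (squares_matrix hQ a'_squares) -phi_im big_imset /=; last first.
  by move=> f f' _ _; apply: phi_inj.
rewrite [RHS](reindex_onto enum_val enum_rank) => [|f _]; last exact: enum_rankK.
apply: eq_big => [j|j _]; first by rewrite enum_valK eqxx in_setT.
rewrite !mxE /coedge !ffunE !outE /=; ring.
Qed.

End Recovery.

Theorem theorem7p7 (R : realType) (g : nat) (Q : 'M[R]_g) (hQ : posdef Q) :
  always_outputs (schottky_decision Q) (fun out : decision_output R g =>
    ((exists D : retained_data R g, out = Yes D) <-> tropical_jacobian_locus Q) /\
    (forall D : retained_data R g, out = Yes D ->
      always_outputs (schottky_recovery D) (fun Gam : recovery_output R g =>
        [/\ is_metric_graph (out_len Gam),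
            integral_cycle_basis (out_basis Gam)
          & riemann_matrix (out_len Gam) (out_basis Gam) = Q]))).
Proof.
split=> [|r hr]; first exact: ex_shortest_representative.
cbv zeta; set lambda := schottky_lambda _; set E := [set e | _].
case: existsP => [[e /andP[e0 le0]]|noneg] /=.
  split=> //; split=> [[]//|/(locus_cographic hr)[/(_ e e0)]].
  by rewrite leNgt le0.
have lambda0 e : e != 0 -> 0 <= lambda e.
  by move=> e0; rewrite leNgt; apply/negP => le0; apply: noneg; exists e; rewrite e0.
case: asboolP => [cogE|nocog] /=; last first.
  by split=> //; split=> [[]//|/(locus_cographic hr)[_]].
split; first exact: cographic_connected.
move=> [G phi] /= [connG isoG].
have lambda_gt0 e : e \in E -> 0 < lambda e by rewrite inE => /andP[].
have E0 : 0 \notin E by rewrite inE eqxx.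
have r_weight := nonneg_weight hQ hr lambda0.
split.
  split=> _; first exact: (decision_sound hQ lambda_gt0 hr r_weight connG isoG).
  by eexists.
move=> D [<-]; exact: (recovery_correct hQ lambda_gt0 E0 hr r_weight connG isoG).
Qed.
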